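(* Let $\Bbbk$ be a field, let $A_n$ be the linearly oriented quiver $1\to2\to\cdots\to n$, and let $T(\Bbbk A_n)$ be the trivial extension of its path algebra. Let $M$ be a basic $\tau$-rigid $T(\Bbbk A_n)$-module. If $L(P_i)\notin\operatorname{add}M$ for every $1\le i\le n$, then $|M|\le n-1$. Consequently, every basic $\tau$-tilting $T(\Bbbk A_n)$-module contains a direct summand of the form $L(P_i)$ for some $1\le i\le n$.
   Context: All modules are finite-dimensional left modules, with $\Bbbk A_n$-modules identified with representations of the quiver. $P_i$ is the indecomposable projective $\Bbbk A_n$-module at vertex $i$ (supported on $i,i+1,\dots,n$). For a finite-dimensional $\Bbbk$-algebra $A$, $D=\mathrm{Hom}_\Bbbk(-,\Bbbk)$ and $T(A)=A\ltimes D(A)$ is the $\Bbbk$-algebra on $A\oplus D(A)$ with multiplication $(a,f)(b,g)=(ab,ag+fb)$, where $(af)(x)=f(xa)$, $(fa)(x)=f(ax)$. Let $\nu=DA\otimes_A-$. A $T(A)$-module is identified with a pair $(X,\alpha)$, where $X$ is an $A$-module and $\alpha:\nu(X)\to X$ satisfies $\alpha\circ\nu(\alpha)=0$. Put $L(X)=\left(X\oplus\nu(X),\begin{pmatrix}0&0\\1&0\end{pmatrix}\right)$; the modules $L(P_1),\dots,L(P_n)$ are exactly the indecomposable projective $T(\Bbbk A_n)$-modules up to isomorphism. For a finite-dimensional algebra $B$ and a $B$-module $M$: $|M|$ is the number of isomorphism classes of indecomposable direct summands of $M$, and $|B|$ is that of $B$ as a module over itself; $M$ is basic if it is a direct sum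 of pairwise non-isomorphic indecomposables; $\operatorname{add}M$ is the class of direct summands of finite direct sums of copies of $M$; $M$ is $\tau$-rigid if $\mathrm{Hom}_B(M,\tau M)=0$, where $\tau$ is the Auslander–Reiten translation of $B$; $M$ is $\tau$-tilting if it is $\tau$-rigid and $|M|=|B|$. *)

(* Defs.v *)
From HB Require Import structures.
From mathcomp Require Import all_boot all_order all_algebra all_field.

Set Implicit Arguments.
Unset Strict Implicit.
Unset Printing Implicit Defensive.

Import GRing.Theory.
Local Open Scope ring_scope.

Section Quotient.
Variables (k : fieldType) (V : vectType k) (U : {vspace V}).

(* V / U, realised on the complement of U chosen by the library; [qproj] is
   the projection, with kernel U. *)
Definition qspace : vectType k := subvs_of (U^C)%VS.

Definition qproj : 'Hom(V, qspace) :=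
  linfun (vsproj (U^C)%VS \o daddv_pi (U^C)%VS U).

Definition qrep (x : qspace) : V := vsval x.

Lemma qprojE v : vsval (qproj v) = daddv_pi (U^C)%VS U v.
Proof. by rewrite lfunE /= vsprojK // memv_pi. Qed.

Lemma qrepK x : qproj (qrep x) = x.
Proof.
apply: val_inj; rewrite /= qprojE daddv_pi_id ?subvsP //.
by rewrite capvC capv_compl.
Qed.

Lemma qprojP v : qproj v = 0 <-> v \in U.
Proof.
have defV : daddv_pi U (U^C)%VS v + daddv_pi (U^C)%VS U v = v.
  by apply: daddv_pi_add; rewrite ?capv_compl ?addv_complf ?memvf.
split=> [/(congr1 vsval)|Uv].
  by rewrite qprojE linear0 => v0; rewrite -defV v0 addr0 memv_pi.
apply: val_inj; rewrite /= qprojE; apply: (addrI v).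
by rewrite -{1}(daddv_pi_id (capv_compl U) Uv) defV addr0.
Qed.

Lemma qproj_qrep v : qrep (qproj v) - v \in U.
Proof. by apply/qprojP; rewrite linearB /= qrepK subrr. Qed.

Lemma qrep_is_linear : linear qrep. Proof. by []. Qed.

End Quotient.

Section Modules.
Variables (k : fieldType) (B : falgType k).

(* Left and right B-modules; finite-dimensional because the carrier is a
   vectType. *)
Record fdmod := FdMod {
  fdsort :> vectType k;
  lact : B -> fdsort -> fdsort;
  lact_linearl : forall x, linear (lact^~ x);
  lact_linearr : forall b, linear (lact b);
  lact1 : forall x, lact 1 x = x;
  lactM : forall a b x, lact (a * b) x = lact a (lact b x) }.

Record fdrmod := FdRMod {
  fdrsort :> vectType k;
  ract : fdrsort -> B -> fdrsort;
  ract_linearr : forall x, linear (ract x);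
  ract_linearl : forall b, linear (ract^~ b);
  ract1 : forall x, ract x 1 = x;
  ractM : forall a b x, ract x (a * b) = ract (ract x a) b }.

End Modules.

Arguments lact {k B} _ _ _.
Arguments ract {k B} _ _ _.

Section ModuleTheory.
Variables (k : fieldType) (B : falgType k).
Implicit Types (M N X Y P : fdmod B) (a b : B).

HB.instance Definition _ M b :=
  GRing.isSemilinear.Build k M M _ (lact M b)
    (GRing.semilinear_linear (lact_linearr (f:=M) b)).

Lemma lactDl M a b x : lact M (a + b) x = lact M a x + lact M b x.
Proof. by have := lact_linearl x 1 a b; rewrite !scale1r. Qed.

Lemma lact0l M x : lact M 0 x = 0.
Proof. by apply: (addrI (lact M 0 x)); rewrite -lactDl !addr0. Qed.

Lemma lactZl M c b x : lact M (c *: b) x = c *: lact M b x.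
Proof. by have := lact_linearl x c b 0; rewrite lact0l !addr0. Qed.

Lemma lact_sum M (I : Type) (r : seq I) (c : I -> k) (e : I -> B) x :
  lact M (\sum_(i <- r) c i *: e i) x = \sum_(i <- r) c i *: lact M (e i) x.
Proof.
elim/big_rec2: _ => [|i y z _ IH]; first exact: lact0l.
by rewrite lactDl lactZl IH.
Qed.

Definition lmul M b : 'End(M) := linfun (lact M b).

Lemma lmulE M b x : lmul M b x = lact M b x. Proof. exact: lfunE. Qed.

Definition is_hom M N (f : 'Hom(M, N)) : Prop :=
  forall b x, f (lact M b x) = lact N b (f x).

Definition hom_defect M N b (f : 'Hom(M, N)) : 'Hom(M, N) :=
  (f \o lmul M b)%VF - (lmul N b \o f)%VF.

Lemma hom_defectE M N b (f : 'Hom(M, N)) x :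
  hom_defect b f x = f (lact M b x) - lact N b (f x).
Proof. by rewrite add_lfunE opp_lfunE !comp_lfunE !lmulE. Qed.

Fact hom_defect_linear M N b : linear (@hom_defect M N b).
Proof.
move=> c f g; apply/lfunP=> x.
rewrite !(hom_defectE, add_lfunE, scale_lfunE) linearP /= scalerBr opprD.
by rewrite addrACA.
Qed.

HB.instance Definition _ M N b :=
  GRing.isSemilinear.Build k 'Hom(M, N) 'Hom(M, N) _ (@hom_defect M N b)
    (GRing.semilinear_linear (@hom_defect_linear M N b)).

(* Hom_B(M, N) as a subspace of Hom_k(M, N): commuting with a k-basis of B
   suffices (homvP). *)
Definition homv M N : {vspace 'Hom(M, N)} :=
  (\bigcap_(i < \dim {:B}) lker (linfun (hom_defect (vbasis {:B})`_i)))%VS.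

Lemma homvP M N (f : 'Hom(M, N)) : f \in homv M N <-> is_hom f.
Proof.
split=> [fB b x | fB]; last first.
  rewrite memvE; apply/subv_bigcapP=> i _; rewrite -memvE memv_ker lfunE /=.
  by apply/eqP/lfunP=> x; rewrite hom_defectE fB subrr zero_lfunE.
rewrite (coord_vbasis (memvf b)) !lact_sum linear_sum /=.
apply: eq_bigr => i _; rewrite linearZ /=; congr (_ *: _).
move: fB; rewrite memvE => /subv_bigcapP/(_ i isT).
rewrite -memvE memv_ker lfunE /= => /eqP/lfunP/(_ x).
by rewrite hom_defectE zero_lfunE => /eqP; rewrite subr_eq0 => /eqP.
Qed.

Definition iso M N : Prop :=
  exists2 f : 'Hom(M, N), is_hom f & bijective f.

Fact zeromod_linearl (x : 'rV[k]_0) : linear (fun _ : B => x).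
Proof. by move=> c a b; rewrite [LHS]thinmx0 [RHS]thinmx0. Qed.

Definition zeromod : fdmod B :=
  @FdMod k B 'rV[k]_0 (fun _ x => x) zeromod_linearl
    (fun _ _ _ _ => erefl) (fun _ => erefl) (fun _ _ _ => erefl).

Section Dsum.
Variables M N : fdmod B.
Let act b (x : M * N) : M * N := (lact M b x.1, lact N b x.2).
Fact dsum_linearl x : linear (act^~ x).
Proof. by move=> c a b; rewrite /act !lactDl !lactZl. Qed.
Fact dsum_linearr b : linear (act b).
Proof. by move=> c x y; rewrite /act !linearP. Qed.
Fact dsum1 x : act 1 x = x.
Proof. by case: x => x y; rewrite /act !lact1. Qed.
Fact dsumM a b x : act (a * b) x = act a (act b x).
Proof. by rewrite /act !lactM. Qed.
Definition dsum : fdmod B :=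
  @FdMod k B (M * N)%type act dsum_linearl dsum_linearr dsum1 dsumM.
End Dsum.

Definition dsums m (X : 'I_m -> fdmod B) : fdmod B :=
  \big[dsum/zeromod]_(i < m) X i.

Definition is_summand X M : Prop := exists Y, iso M (dsum X Y).

Definition in_add X M : Prop :=
  exists m, is_summand X (dsums (fun _ : 'I_m => M)).

Definition is_zero M : Prop := forall x : M, x = 0.

Definition indecomposable M : Prop :=
  ~ is_zero M /\
  forall X Y, iso M (dsum X Y) -> is_zero X \/ is_zero Y.

Definition basic M : Prop :=
  exists m (X : 'I_m -> fdmod B),
    [/\ forall i, indecomposable (X i),
        forall i j, iso (X i) (X j) -> i = j
      & iso M (dsums X)].

(* |M| = m: the isomorphism classes of indecomposable direct summands of M
   are represented, without repetition, by m modules. *)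
Definition num_summands M (m : nat) : Prop :=
  exists X : 'I_m -> fdmod B,
    [/\ forall i, indecomposable (X i) /\ is_summand (X i) M,
        forall i j, iso (X i) (X j) -> i = j
      & forall Y, indecomposable Y -> is_summand Y M -> exists i, iso Y (X i)].

Fact regmod_linearl (x : B) : linear (fun b : B => b * x).
Proof. by move=> c a b; rewrite mulrDl scalerAl. Qed.
Fact regmod_linearr (b : B) : linear (fun x : B => b * x).
Proof. by move=> c x y; rewrite mulrDr scalerAr. Qed.
Definition regmod : fdmod B :=
  @FdMod k B B (fun b x => b * x) regmod_linearl regmod_linearr
    (@mul1r B) (fun a b x => esym (mulrA a b x)).

Definition stable M (U : {vspace M}) : Prop :=
  forall b x, x \in U -> lact M b x \in U.

Section Submodule.
Variables (M : fdmod B) (U : {vspace M}) (stU : stable U).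
Let act b (x : subvs_of U) : subvs_of U := Subvs (stU b (subvsP x)).
Fact submod_linearl x : linear (act^~ x).
Proof. by move=> c a b; apply: val_inj; rewrite /= lactDl lactZl. Qed.
Fact submod_linearr b : linear (act b).
Proof. by move=> c x y; apply: val_inj; rewrite /= linearP. Qed.
Fact submod1 x : act 1 x = x.
Proof. by apply: val_inj; rewrite /= lact1. Qed.
Fact submodM a b x : act (a * b) x = act a (act b x).
Proof. by apply: val_inj; rewrite /= lactM. Qed.
Definition submod : fdmod B :=
  @FdMod k B (subvs_of U) act submod_linearl submod_linearr submod1 submodM.
End Submodule.

Definition projective P : Prop :=
  forall M N (g : 'Hom(M, N)) (f : 'Hom(P, N)),
    is_hom g -> limg g = fullv -> is_hom f ->
    exists2 h : 'Hom(P, M), is_hom h & (g \o h)%VF = f.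

Definition superfluous M (U : {vspace M}) : Prop :=
  forall W : {vspace M}, stable W -> (W + U)%VS = fullv -> W = fullv.

(* P1 --d--> P0 --e--> M --> 0 is exact, with P0 -> M and P1 -> Im d = Ker e
   projective covers. *)
Definition min_proj_pres P1 P0 M (d : 'Hom(P1, P0)) (e : 'Hom(P0, M)) : Prop :=
  [/\ projective P1 /\ projective P0,
      is_hom d /\ is_hom e,
      limg e = fullv /\ limg d = lker e
    & superfluous (lker d) /\ superfluous (lker e)].

End ModuleTheory.

Arguments regmod {k} B.

Section RightModules.
Variables (k : fieldType) (B : falgType k).
Implicit Types (M N P : fdmod B) (R : fdrmod B).

Definition ract_by R b (x : R) : R := ract R x b.

HB.instance Definition _ R b :=
  GRing.isSemilinear.Build k R R _ (@ract_by R b)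
    (GRing.semilinear_linear (ract_linearl (f:=R) b)).

HB.instance Definition _ R x :=
  GRing.isSemilinear.Build k B R _ (ract R x)
    (GRing.semilinear_linear (ract_linearr (f:=R) x)).

Definition rmul R b : 'End(R) := linfun (@ract_by R b).

Lemma rmulE R b x : rmul R b x = ract R x b. Proof. exact: lfunE. Qed.

(* Hom_B(M, B), with (g b)(x) = g(x) b. *)
Section Homr.
Variable M : fdmod B.
Let H := subvs_of (homv M (regmod B)).
Fact homr_subproof (g : H) b : (amulr b \o vsval g)%VF \in homv M (regmod B).
Proof.
apply/homvP => a x; rewrite !comp_lfunE !lfunE /=.
by rewrite ((homvP _).1 (subvsP g) a x) /= mulrA.
Qed.
Let act (g : H) b : H := Subvs (homr_subproof g b).
Fact homr_linearr g : linear (act g).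
Proof. by move=> c a b; apply: val_inj; rewrite /= linearP comp_lfunDl comp_lfunZl. Qed.
Fact homr_linearl b : linear (act^~ b).
Proof. by move=> c f g; apply: val_inj; rewrite /= comp_lfunDr comp_lfunZr. Qed.
Fact homr1 g : act g 1 = g.
Proof. by apply: val_inj; apply/lfunP => x; rewrite /= comp_lfunE lfunE /= mulr1. Qed.
Fact homrM a b g : act g (a * b) = act (act g a) b.
Proof.
by apply: val_inj; apply/lfunP => x; rewrite /= !comp_lfunE !lfunE /= mulrA.
Qed.
Definition homr : fdrmod B :=
  @FdRMod k B H act homr_linearr homr_linearl homr1 homrM.
End Homr.

(* d^* : Hom_B(N, B) -> Hom_B(M, B), g |-> g \o d. *)
Section Homd.
Variables (M N : fdmod B) (d : 'Hom(M, N)) (dB : is_hom d).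
Fact homd_subproof (g : homr N) : (vsval g \o d)%VF \in homv M (regmod B).
Proof.
apply/homvP => a x; rewrite !comp_lfunE dB.
by rewrite ((homvP _).1 (subvsP g) a).
Qed.
Definition homd_fun (g : homr N) : homr M := Subvs (homd_subproof g).
Fact homd_is_linear : linear homd_fun.
Proof. by move=> c f g; apply: val_inj; rewrite /= comp_lfunDl comp_lfunZl. Qed.
HB.instance Definition _ :=
  GRing.isSemilinear.Build k (homr N) (homr M) _ homd_fun
    (GRing.semilinear_linear homd_is_linear).
Definition homd : 'Hom(homr N, homr M) := linfun homd_fun.
Lemma homd_rstable b x : x \in limg homd -> ract (homr M) x b \in limg homd.
Proof.
case/memv_imgP=> g _ ->; apply/memv_imgP; exists (ract (homr N) g b).
  exact: memvf.
by apply: val_inj; rewrite !lfunE /= comp_lfunA.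
Qed.
End Homd.

Section QuotientR.
Variables (R : fdrmod B) (U : {vspace R}).
Hypothesis stU : forall b x, x \in U -> ract R x b \in U.
Let act (x : qspace U) b : qspace U := qproj U (ract R (qrep x) b).
Fact rquot_linearr x : linear (act x).
Proof. by move=> c a b; rewrite /act !linearP. Qed.
Fact rquot_linearl b : linear (act^~ b).
Proof. by move=> c x y; rewrite /act qrep_is_linear ract_linearl linearP. Qed.
Fact rquot1 x : act x 1 = x.
Proof. by rewrite /act ract1 qrepK. Qed.
Fact rquotM a b x : act x (a * b) = act (act x a) b.
Proof.
rewrite /act ractM; apply/eqP; rewrite -subr_eq0 -linearB /=; apply/eqP/qprojP.
rewrite -[X in X - _ \in _]/(ract_by b _) -[X in _ - X \in _]/(ract_by b _).
rewrite -linearB /=; apply: stU.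
by rewrite -opprB memvN qproj_qrep.
Qed.
Definition rquot : fdrmod B :=
  @FdRMod k B (qspace U) act rquot_linearr rquot_linearl rquot1 rquotM.
End QuotientR.

(* The left module D(R), with (b f)(x) = f(x b). *)
Section Dual.
Variable R : fdrmod B.
Let DR := 'Hom(R, k^o).
Let act b (f : DR) : DR := (f \o rmul R b)%VF.
Fact rdual_linearl f : linear (act^~ f).
Proof.
move=> c a b; apply/lfunP => x.
by rewrite add_lfunE scale_lfunE !comp_lfunE !rmulE !linearP.
Qed.
Fact rdual_linearr b : linear (act b).
Proof. by move=> c f g; rewrite /act comp_lfunDl comp_lfunZl. Qed.
Fact rdual1 f : act 1 f = f.
Proof. by apply/lfunP => x; rewrite comp_lfunE rmulE ract1. Qed.
Fact rdualM a b f : act (a * b) f = act a (act b f).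
Proof. by apply/lfunP => x; rewrite !comp_lfunE !rmulE ractM. Qed.
Definition rdual : fdmod B :=
  @FdMod k B DR act rdual_linearl rdual_linearr rdual1 rdualM.
End Dual.

(* Tr M = Coker (d^* : Hom_B(P0, B) -> Hom_B(P1, B)). *)
Definition transpose P1 P0 (d : 'Hom(P1, P0)) (dB : is_hom d) : fdrmod B :=
  rquot (@homd_rstable P1 P0 d dB).

(* N is (isomorphic to) the Auslander-Reiten translate D Tr M of M; minimal
   projective presentations being unique up to isomorphism, so is N. *)
Definition is_tau M N : Prop :=
  exists (P1 P0 : fdmod B) (d : 'Hom(P1, P0)) (e : 'Hom(P0, M)) (dB : is_hom d),
    min_proj_pres d e /\ iso N (rdual (transpose dB)).

Definition tau_rigid M : Prop :=
  exists2 N, is_tau M N &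
    forall f : 'Hom(M, N), is_hom f -> f = 0.

Definition tau_tilting M : Prop :=
  tau_rigid M /\
  exists2 m, num_summands M m & num_summands (regmod B) m.

End RightModules.

Section TrivialExtension.
Variables (k : fieldType) (A : falgType k).

(* The two actions of A on D(A): (af)(x) = f(xa) and (fa)(x) = f(ax). *)
Definition dlact (a : A) (f : 'Hom(A, k^o)) : 'Hom(A, k^o) := (f \o amulr a)%VF.
Definition dract (f : 'Hom(A, k^o)) (a : A) : 'Hom(A, k^o) := (f \o amull a)%VF.

Lemma dlactE a f x : dlact a f x = f (x * a).
Proof. by rewrite comp_lfunE lfunE. Qed.
Lemma dractE f a x : dract f a x = f (a * x).
Proof. by rewrite comp_lfunE lfunE. Qed.

Definition trivext := (A * 'Hom(A, k^o))%type.
HB.instance Definition _ := Vector.on trivext.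

Definition te_one : trivext := (1, 0).
Definition te_mul (x y : trivext) : trivext :=
  (x.1 * y.1, dlact x.1 y.2 + dract x.2 y.1).

Let teE := (add_lfunE, scale_lfunE, opp_lfunE, zero_lfunE, dlactE, dractE).

Fact te_mulA : associative te_mul.
Proof.
move=> [a f] [b g] [c h]; congr (_, _); rewrite /= ?mulrA //.
by apply/lfunP=> x; rewrite !teE !mulrA addrA.
Qed.
Fact te_mul1l : left_id te_one te_mul.
Proof.
move=> [a f]; congr (_, _); rewrite /= ?mul1r //.
by apply/lfunP=> x; rewrite !teE mulr1 addr0.
Qed.
Fact te_mul1r : right_id te_one te_mul.
Proof.
move=> [a f]; congr (_, _); rewrite /= ?mulr1 //.
by apply/lfunP=> x; rewrite !teE mul1r add0r.
Qed.
Fact te_mulDl : left_distributive te_mul +%R.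
Proof.
move=> [a f] [b g] [c h]; congr (_, _); rewrite /= ?mulrDl //.
by apply/lfunP=> x; rewrite !teE mulrDr linearD addrACA.
Qed.
Fact te_mulDr : right_distributive te_mul +%R.
Proof.
move=> [a f] [b g] [c h]; congr (_, _); rewrite /= ?mulrDr //.
by apply/lfunP=> x; rewrite !teE mulrDl linearD addrACA.
Qed.
Fact te_one_neq0 : te_one != 0.
Proof. by rewrite -[0]/(0, 0) xpair_eqE oner_eq0. Qed.

HB.instance Definition _ := GRing.Zmodule_isNzRing.Build trivext
  te_mulA te_mul1l te_mul1r te_mulDl te_mulDr te_one_neq0.

Fact te_scaleAl (c : k) (x y : trivext) : c *: (x * y) = (c *: x) * y.
Proof.
case: x y => [a f] [b g]; congr (_, _); rewrite /= ?scalerAl //.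
by apply/lfunP=> x; rewrite !teE -scalerAr linearZ scalerDr.
Qed.
HB.instance Definition _ := GRing.Lmodule_isLalgebra.Build k trivext te_scaleAl.
Fact te_scaleAr (c : k) (x y : trivext) : c *: (x * y) = x * (c *: y).
Proof.
case: x y => [a f] [b g]; congr (_, _); rewrite /= ?scalerAr //.
by apply/lfunP=> x; rewrite !teE -scalerAl linearZ scalerDr.
Qed.
HB.instance Definition _ := GRing.Lalgebra_isAlgebra.Build k trivext te_scaleAr.
HB.instance Definition _ := Algebra_isFalgebra.Build k trivext.

End TrivialExtension.

Lemma linfun_linearE (k : fieldType) (V W : vectType k) (F : V -> W) :
  linear F -> linfun F =1 F.
Proof.
move=> linF.
pose mixin := GRing.isSemilinear.Build k V W _ F (GRing.semilinear_linear linF).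
pose G : {linear V -> W} := HB.pack F mixin.
exact: (lfunE G).
Qed.

Section Nakayama.
Variables (k : fieldType) (A : falgType k).
Implicit Types (X Y : fdmod A) (f g : 'Hom(A, k^o)) (a b : A).

(* D(A) \otimes_k X is realised as Hom_k(A, X), where f \otimes x is the map
   a |-> f(a) x (A being finite-dimensional); D(A) \otimes_A X is its quotient
   by the relations (f b) \otimes x = f \otimes (b x). *)
Definition tensk X f (x : X) : 'Hom(A, X) :=
  (linfun (fun c : k^o => (c : k) *: x) \o f)%VF.

Lemma tenskE X f (x : X) a : tensk f x a = (f a : k) *: x.
Proof.
rewrite comp_lfunE.
rewrite (@linfun_linearE k k^o X) // => c u v.
by rewrite scalerDl scalerA.
Qed.

Lemma tenskDl X (x : X) c f g : tensk (c *: f + g) x = c *: tensk f x + tensk g x.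
Proof.
apply/lfunP=> a; rewrite !(add_lfunE, scale_lfunE, tenskE).
by rewrite scalerDl scalerA.
Qed.

Lemma tenskDr X f c (x y : X) : tensk f (c *: x + y) = c *: tensk f x + tensk f y.
Proof.
apply/lfunP=> a; rewrite !(add_lfunE, scale_lfunE, tenskE).
by rewrite scalerDr !scalerA mulrC.
Qed.

Lemma tensk0l X (x : X) : tensk 0 x = 0.
Proof. by apply/lfunP=> a; rewrite tenskE !zero_lfunE scale0r. Qed.

Lemma tensk0r X f : tensk f (0 : X) = 0.
Proof. by apply/lfunP=> a; rewrite tenskE zero_lfunE scaler0. Qed.

Definition dcoord (i : 'I_(\dim {:A})) : 'Hom(A, k^o) :=
  linfun (coord (vbasis {:A}) i : A -> k^o).

Lemma dcoordE i a : dcoord i a = coord (vbasis {:A}) i a.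
Proof. exact: (lfunE (coord (vbasis {:A}) i : {linear A -> k^o})). Qed.

Lemma dcoord_span f : f = \sum_(i < \dim {:A}) (f (vbasis {:A})`_i : k) *: dcoord i.
Proof.
apply/lfunP=> a; rewrite sum_lfunE {1}(coord_vbasis (memvf a)) linear_sum /=.
apply: eq_bigr => i _; rewrite scale_lfunE linearZ /= dcoordE.
exact: mulrC.
Qed.

Lemma tensk_span X (h : 'Hom(A, X)) :
  h = \sum_(i < \dim {:A}) tensk (dcoord i) (h (vbasis {:A})`_i).
Proof.
apply/lfunP=> a; rewrite sum_lfunE {1}(coord_vbasis (memvf a)) linear_sum /=.
apply: eq_bigr => i _; rewrite tenskE linearZ /=; congr (_ *: _).
by rewrite dcoordE.
Qed.

Definition nu_relator X f b (x : X) : 'Hom(A, X) :=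
  tensk (dract f b) x - tensk f (lact X b x).

Definition nu_rel X : {vspace 'Hom(A, X)} :=
  (\sum_(i < \dim {:'Hom(A, k^o)}) \sum_(j < \dim {:A}) \sum_(l < \dim {:X})
     <[nu_relator (vbasis {:'Hom(A, k^o)})`_i (vbasis {:A})`_j (vbasis {:X})`_l]>)%VS.

Lemma dractDl c f g b : dract (c *: f + g) b = c *: dract f b + dract g b.
Proof. by rewrite /dract comp_lfunDl comp_lfunZl. Qed.

Lemma dractDr c f a b : dract f (c *: a + b) = c *: dract f a + dract f b.
Proof. by rewrite /dract linearP comp_lfunDr comp_lfunZr. Qed.

Lemma nu_relator_mem X f b (x : X) : nu_relator f b x \in nu_rel X.
Proof.
have linf b' x' : linear (fun f => @nu_relator X f b' x').
  move=> c f1 f2; rewrite /nu_relator dractDl !tenskDl scalerBr opprD.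
  by rewrite addrACA.
have linb f' x' : linear (fun b => @nu_relator X f' b x').
  move=> c b1 b2; rewrite /nu_relator dractDr tenskDl lactDl lactZl tenskDr.
  by rewrite scalerBr opprD addrACA.
have linx f' b' : linear (fun x => @nu_relator X f' b' x).
  move=> c x1 x2; rewrite /nu_relator linearP /= !tenskDr.
  by rewrite scalerBr opprD addrACA.
have lin_mem (V : vectType k) (F : V -> 'Hom(A, X)) (v : V) (U : {vspace _}) :
    linear F -> (forall i : 'I_(\dim {:V}), F (vbasis {:V})`_i \in U) -> F v \in U.
  move=> linF FU.
  rewrite -(linfun_linearE linF) (coord_vbasis (memvf v)) linear_sum /=.
  apply: memv_suml => i _; rewrite linearZ memvZ //=.
  by rewrite (linfun_linearE linF).
apply: (lin_mem _ _ f _ (linf b x)) => i.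
apply: (lin_mem _ _ b _ (linb _ x)) => j.
apply: (lin_mem _ _ x _ (linx _ _)) => l.
rewrite memvE; apply: (sumv_sup i) => //; apply: (sumv_sup j) => //.
exact: (sumv_sup l).
Qed.

Lemma nu_rel_sub X (U : {vspace 'Hom(A, X)}) :
  (forall f b x, nu_relator f b x \in U) -> (nu_rel X <= U)%VS.
Proof.
move=> HU; apply/subv_sumP=> i _; apply/subv_sumP=> j _; apply/subv_sumP=> l _.
by rewrite -memvE HU.
Qed.

Lemma nu_rel_linear X (V : vectType k) (F : 'Hom('Hom(A, X), V))
    (U : {vspace V}) :
  (forall f b x, F (nu_relator f b x) \in U) ->
  forall h, h \in nu_rel X -> F h \in U.
Proof.
move=> HF h; rewrite memv_preim; apply/subvP: h.
by apply: nu_rel_sub => f b x; rewrite -memv_preim.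
Qed.

Definition nu_sp X : vectType k := qspace (nu_rel X).

(* The left A-action on D(A) \otimes_A X: a (f \otimes x) = (a f) \otimes x. *)
Definition nuk_act X a : 'End('Hom(A, X)) :=
  linfun (fun h : 'Hom(A, X) => (h \o amulr a)%VF).
Lemma nuk_actE X a (h : 'Hom(A, X)) : nuk_act X a h = (h \o amulr a)%VF.
Proof.
apply: linfun_linearE => c f g.
by rewrite comp_lfunDl comp_lfunZl.
Qed.

Lemma nuk_act_tensk X a f (x : X) : nuk_act X a (tensk f x) = tensk (dlact a f) x.
Proof.
by rewrite nuk_actE; apply/lfunP=> b; rewrite comp_lfunE !tenskE dlactE !lfunE.
Qed.

Lemma dlact_dract a f b : dlact a (dract f b) = dract (dlact a f) b.
Proof. by apply/lfunP=> x; rewrite !(dlactE, dractE) mulrA. Qed.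

Lemma nuk_act_rel X a h : h \in nu_rel X -> nuk_act X a h \in nu_rel X.
Proof.
apply: nu_rel_linear => f b x.
by rewrite linearB /= !nuk_act_tensk dlact_dract nu_relator_mem.
Qed.

Section NuModule.
Variable X : fdmod A.
Let act a (h : nu_sp X) : nu_sp X := qproj (nu_rel X) (nuk_act X a (qrep h)).
Fact nu_linearl h : linear (act^~ h).
Proof.
move=> c a b; rewrite /act -linearP; congr (qproj _ _).
by rewrite !nuk_actE linearP comp_lfunDr comp_lfunZr.
Qed.
Fact nu_linearr a : linear (act a).
Proof. by move=> c g h; rewrite /act qrep_is_linear !linearP. Qed.
Fact nu1 h : act 1 h = h.
Proof.
rewrite /act nuk_actE -[RHS]qrepK; congr (qproj _ _).
by apply/lfunP=> x; rewrite comp_lfunE lfunE /= mulr1.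
Qed.
Fact nuM a b h : act (a * b) h = act a (act b h).
Proof.
rewrite /act; apply/eqP; rewrite -subr_eq0 -linearB /=; apply/eqP/qprojP.
have -> : nuk_act X (a * b) (qrep h) = nuk_act X a (nuk_act X b (qrep h)).
  by rewrite !nuk_actE; apply/lfunP=> x; rewrite !comp_lfunE !lfunE /= mulrA.
rewrite -linearB /=; apply: nuk_act_rel.
by rewrite -opprB memvN qproj_qrep.
Qed.
Definition nu : fdmod A := @FdMod k A (nu_sp X) act nu_linearl nu_linearr nu1 nuM.
End NuModule.

Definition tens X f (x : X) : nu X := qproj (nu_rel X) (tensk f x).

Lemma tensB X f b (x : X) : tens (dract f b) x = tens f (lact X b x).
Proof.
apply/eqP; rewrite -subr_eq0 /tens -linearB; apply/eqP/qprojP.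
exact: nu_relator_mem.
Qed.

Lemma tensDl X (x : X) c f g : tens (c *: f + g) x = c *: tens f x + tens g x.
Proof. by rewrite /tens tenskDl linearP. Qed.

Lemma tensDr X f c (x y : X) : tens f (c *: x + y) = c *: tens f x + tens f y.
Proof. by rewrite /tens tenskDr linearP. Qed.

Lemma tens_ext X (V : vectType k) (F G : 'Hom(nu X, V)) :
  (forall f x, F (tens f x) = G (tens f x)) -> F = G.
Proof.
move=> FG; apply/lfunP=> h; rewrite -[h](qrepK (U := nu_rel X)) [qrep h]tensk_span.
by rewrite !linear_sum; apply: eq_bigr => i _; apply: FG.
Qed.

Lemma nu_tens X a f (x : X) : lact (nu X) a (tens f x) = tens (dlact a f) x.
Proof.
rewrite /= /tens -nuk_act_tensk.
apply/eqP; rewrite -subr_eq0 -linearB /=; apply/eqP/qprojP.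
by rewrite -linearB /=; apply: nuk_act_rel; apply: qproj_qrep.
Qed.

(* nu on morphisms: f \otimes x |-> f \otimes phi(x). *)
Section NuMap.
Variables (X Y : fdmod A) (phi : 'Hom(X, Y)).
Definition nu_map_fun (h : nu X) : nu Y := qproj (nu_rel Y) (phi \o qrep h)%VF.
Fact nu_map_is_linear : linear nu_map_fun.
Proof.
move=> c g h; rewrite /nu_map_fun -linearP qrep_is_linear.
by rewrite comp_lfunDr comp_lfunZr.
Qed.
HB.instance Definition _ := GRing.isSemilinear.Build k (nu X) (nu Y) _ nu_map_fun
  (GRing.semilinear_linear nu_map_is_linear).
Definition nu_map : 'Hom(nu X, nu Y) := linfun nu_map_fun.

Lemma nu_mapE f x : is_hom phi -> nu_map (tens f x) = tens f (phi x).
Proof.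
move=> homphi; rewrite lfunE /= /nu_map_fun /tens.
have phi_tensk g y : (phi \o tensk g y)%VF = tensk g (phi y).
  by apply/lfunP=> a; rewrite comp_lfunE !tenskE linearZ.
rewrite -phi_tensk.
apply/eqP; rewrite -subr_eq0 -linearB /=; apply/eqP/qprojP.
rewrite -comp_lfunNr -comp_lfunDr.
have lin : linear (fun h : 'Hom(A, X) => (phi \o h)%VF).
  by move=> c g h; rewrite comp_lfunDr comp_lfunZr.
rewrite -(linfun_linearE lin); apply: nu_rel_linear (qproj_qrep _ _) => g b y.
rewrite (linfun_linearE lin) comp_lfunDr comp_lfunNr !phi_tensk homphi.
exact: nu_relator_mem.
Qed.
End NuMap.

Lemma nu_lift X (V : vectType k) (beta : 'Hom(A, k^o) -> X -> V) :
  (forall x, linear (beta^~ x)) -> (forall f, linear (beta f)) ->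
  (forall f b x, beta (dract f b) x = beta f (lact X b x)) ->
  exists F : 'Hom(nu X, V), forall f x, F (tens f x) = beta f x.
Proof.
move=> linl linr bal.
pose G (h : 'Hom(A, X)) : V := \sum_(i < \dim {:A}) beta (dcoord i) (h (vbasis {:A})`_i).
have linG : linear G.
  move=> c g h; rewrite /G scaler_sumr -big_split /=; apply: eq_bigr => i _.
  by rewrite add_lfunE scale_lfunE linr.
pose F : 'Hom('Hom(A, X), V) := linfun G.
have FG h : F h = G h := linfun_linearE linG h.
have beta0r f : beta f 0 = 0.
  by have := linr f (-1) 0 0; rewrite scaler0 addr0 scaleN1r addNr.
have beta0l x : beta 0 x = 0.
  by have := linl x (-1) 0 0; rewrite scaler0 addr0 scaleN1r addNr.
have FE f x : F (tensk f x) = beta f x.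
  rewrite FG /G {2}(dcoord_span f).
  transitivity (\sum_(i < \dim {:A}) (f (vbasis {:A})`_i : k) *: beta (dcoord i) x).
    apply: eq_bigr => i _; rewrite tenskE.
    by rewrite -[_ *: x]addr0 linr beta0r addr0.
  elim/big_rec2: _ => [|i y g _ IH]; first by rewrite beta0l.
  by rewrite linl IH.
have Frel h : h \in nu_rel X -> F h = 0.
  move=> hU; apply/eqP; rewrite -memv0; apply: nu_rel_linear hU => f b x.
  by rewrite memv0 linearB /= !FE bal subrr.
have lin' : linear (fun h : nu X => F (qrep h)).
  by move=> c g h; rewrite qrep_is_linear linearP.
exists (linfun (fun h : nu X => F (qrep h))) => f x.
rewrite (linfun_linearE lin') -FE.
apply/eqP; rewrite -subr_eq0 -linearB; apply/eqP/Frel.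
exact: qproj_qrep.
Qed.

End Nakayama.

Section PairModules.
Variables (k : fieldType) (A : falgType k).
Implicit Types (X Y : fdmod A).

Lemma tens0r X f : tens f (0 : X) = 0.
Proof. by rewrite /tens tensk0r linear0. Qed.

Lemma nu_map_hom X Y (phi : 'Hom(X, Y)) : is_hom phi -> is_hom (nu_map phi).
Proof.
move=> hphi a h.
have: (nu_map phi \o lmul (nu X) a = lmul (nu Y) a \o nu_map phi)%VF.
  apply: tens_ext => f x; rewrite !comp_lfunE !lmulE.
  by rewrite nu_tens !nu_mapE // nu_tens.
by move/lfunP/(_ h); rewrite !comp_lfunE !lmulE.
Qed.

(* The T(A)-module given by a pair (X, alpha):
   (a, f) x = a x + alpha (f \otimes x). *)
Section PairModule.
Variables (X : fdmod A) (alpha : 'Hom(nu X, X)).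
Hypotheses (alphaA : is_hom alpha) (alpha2 : (alpha \o nu_map alpha)%VF = 0).
Let act (t : trivext A) (x : X) : X := lact X t.1 x + alpha (tens t.2 x).
Fact pairmod_linearl x : linear (act^~ x).
Proof.
move=> c [a f] [b g]; rewrite /act /= lactDl lactZl tensDl linearP /=.
by rewrite scalerDr addrACA.
Qed.
Fact pairmod_linearr t : linear (act t).
Proof.
move=> c x y; rewrite /act /= tensDr !linearP /=.
by rewrite scalerDr addrACA.
Qed.
Fact pairmod1 x : act 1 x = x.
Proof.
rewrite /act /= lact1 [tens _ _](_ : _ = 0) ?linear0 ?addr0 //.
by rewrite /tens tensk0l linear0.
Qed.
Fact pairmodM s t x : act (s * t) x = act s (act t x).
Proof.
case: s t => [a f] [b g]; rewrite /act /=.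
have tensD h (u v : X) : tens h (u + v) = tens h u + tens h v.
  by have := tensDr h 1 u v; rewrite !scale1r.
have tensDl' h h' (u : X) : tens (h + h') u = tens h u + tens h' u.
  by have := tensDl u 1 h h'; rewrite !scale1r.
have alphaD u v : alpha (u + v) = alpha u + alpha v by rewrite linearD.
have lactD c (u v : X) : lact X c (u + v) = lact X c u + lact X c v.
  by rewrite linearD.
rewrite tensDl' tensB -(nu_tens a g) tensD !alphaD alphaA lactM lactD.
have a2 : alpha (tens f (alpha (tens g x))) = 0.
  have /lfunP/(_ (tens f (tens g x))) := alpha2.
  by rewrite comp_lfunE nu_mapE // zero_lfunE.
by rewrite a2 addr0 addrA.
Qed.
Definition pairmod : fdmod (trivext A) :=
  @FdMod k (trivext A) X act pairmod_linearl pairmod_linearr pairmod1 pairmodM.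
End PairModule.

(* L(X) = (X (+) nu X, alpha) with alpha = (0 0 ; 1 0), i.e. the composite
   nu(X (+) nu X) -> nu X -> X (+) nu X. *)
Section L.
Variable X : fdmod A.
Let X2 := dsum X (nu X).
Definition L_pr : 'Hom(X2, X) := linfun (fun z : X2 => z.1).
Definition L_in : 'Hom(nu X, X2) := linfun (fun y : nu X => (0, y) : X2).
Definition L_alpha : 'Hom(nu X2, X2) := (L_in \o nu_map L_pr)%VF.

Lemma L_prE z : L_pr z = z.1.
Proof. exact: (@linfun_linearE k X2 X). Qed.
Lemma L_inE y : L_in y = (0, y).
Proof.
apply: (@linfun_linearE k (nu X) X2) => c u v.
by congr (_, _); rewrite /= scaler0 addr0.
Qed.
Fact L_pr_hom : is_hom L_pr.
Proof. by move=> a z; rewrite !L_prE. Qed.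
Fact L_alpha_hom : is_hom L_alpha.
Proof.
move=> a h; rewrite !comp_lfunE (nu_map_hom L_pr_hom) !L_inE.
by congr (_, _); rewrite /= linear0.
Qed.
Fact L_alpha2 : (L_alpha \o nu_map L_alpha)%VF = 0.
Proof.
apply: tens_ext => f z; rewrite comp_lfunE zero_lfunE nu_mapE; last exact: L_alpha_hom.
rewrite comp_lfunE nu_mapE; last exact: L_pr_hom.
by rewrite comp_lfunE L_prE !L_inE /= tens0r.
Qed.
Definition L : fdmod (trivext A) := pairmod L_alpha_hom L_alpha2.

Lemma L_actE (t : trivext A) (z : X * nu X) :
  lact L t z = (lact X t.1 z.1, lact (nu X) t.1 z.2 + tens t.2 z.1).
Proof.
rewrite /= comp_lfunE nu_mapE; last exact: L_pr_hom.
by rewrite L_inE L_prE; congr (_, _); rewrite /= addr0.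
Qed.
End L.

End PairModules.

(* The quiver A_n = 1 -> 2 -> ... -> n, with vertices numbered from 0. There is
   exactly one path from i to j when i <= j, and none otherwise. *)
Definition path_An (n : nat) := {p : 'I_n * 'I_n | p.1 <= p.2}%N.

Section PathAn.
Variable n : nat.
Implicit Types p q r : path_An n.
Definition psrc p : 'I_n := (val p).1.
Definition ptgt p : 'I_n := (val p).2.
Definition mkpath (i j : 'I_n) (le_ij : (i <= j)%N) : path_An n :=
  exist (fun p : 'I_n * 'I_n => (p.1 <= p.2)%N) (i, j) le_ij.
Definition ptriv (i : 'I_n) : path_An n := mkpath (leqnn i).

(* q \o p: first p, then q. *)
Definition pcomp q p : option (path_An n) :=
  if ptgt p == psrc q then
    insub (psrc p, ptgt q) : option {r : 'I_n * 'I_n | (r.1 <= r.2)%N}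
  else None.

Lemma path_eq p q : psrc p = psrc q -> ptgt p = ptgt q -> p = q.
Proof.
by case: p q => [[a b] ?] [[c d] ?]; rewrite /psrc /ptgt /= => ? ?;
  apply: val_inj; congr (_, _).
Qed.

Lemma pcompP q p r :
  (pcomp q p == Some r) =
  [&& ptgt p == psrc q, psrc r == psrc p & ptgt r == ptgt q].
Proof.
rewrite /pcomp; case: (eqVneq (ptgt p) (psrc q)) => [e|_] //=.
have le : ((psrc p, ptgt q).1 <= (psrc p, ptgt q).2)%N.
  by rewrite /= (leq_trans (valP p)) // -/(ptgt p) e (valP q).
rewrite (insubT (fun r : 'I_n * 'I_n => (r.1 <= r.2)%N) le).
apply/eqP/andP=> [[<-]|[/eqP es /eqP et]]; first by rewrite /psrc /ptgt /= !eqxx.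
by congr Some; apply: path_eq; rewrite ?es ?et.
Qed.

Lemma pcompA p q r :
  obind (pcomp p) (pcomp q r) = obind (fun t => pcomp t r) (pcomp p q).
Proof.
have obindE (u v : option (path_An n)) :
    (forall t, (u == Some t) = (v == Some t)) -> u = v.
  case: u v => [u|] [v|] H //; first by have := H u; rewrite eqxx => /esym/eqP.
    by have := H u; rewrite eqxx.
  by have := H v; rewrite eqxx.
apply: obindE => t.
have composable (x y : path_An n) : ptgt y = psrc x ->
    exists2 z, pcomp x y = Some z & psrc z = psrc y /\ ptgt z = ptgt x.
  move=> e; have le : (psrc y <= ptgt x)%N.
    by rewrite (leq_trans (valP y)) // -/(ptgt y) e (valP x).
  by exists (mkpath le) => //; apply/eqP; rewrite pcompP e !eqxx.
case: (eqVneq (ptgt r) (psrc q)) => [e1|n1]; last first.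
  have -> : pcomp q r = None by rewrite /pcomp (negPf n1).
  rewrite /=; case E: (pcomp p q) => [z|] //=.
  move/eqP: E; rewrite pcompP => /and3P[_ /eqP ez _].
  by rewrite /pcomp ez (negPf n1).
have [z -> [zs zt]] := composable _ _ e1; rewrite /=.
case: (eqVneq (ptgt q) (psrc p)) => [e2|n2]; last first.
  by rewrite /pcomp zt (negPf n2).
have [w -> [ws wt]] := composable _ _ e2; rewrite /=.
by rewrite !pcompP zt zs ws wt e1 e2 !eqxx.
Qed.
End PathAn.

(* The path algebra of A_n: functions on the set of paths (the function f
   standing for the sum of the f(p) p), multiplied by convolution. Arrows are
   composed like functions, so that left modules are representations. *)
Definition pathalg (k : fieldType) (n : nat) := {ffun path_An n -> k^o}.

HB.instance Definition _ k n := Vector.on (pathalg k n).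

Section PathAlgebra.
Variables (k : fieldType) (n : nat).
Local Notation PA := (pathalg k n).
Implicit Types f g h : PA.

Definition pa_mul f g : PA :=
  [ffun p => \sum_(qr : path_An n * path_An n | pcomp qr.1 qr.2 == Some p)
               (f qr.1 : k) * (g qr.2 : k)].

Definition pa_path (p : path_An n) : PA := [ffun q => (q == p)%:R].

Definition pa_one : PA := \sum_(i < n) pa_path (ptriv i).

Fact pa_mulDl : left_distributive pa_mul +%R.
Proof.
move=> f g h; apply/ffunP=> p; rewrite !ffunE -big_split /=.
by apply: eq_bigr => qr _; rewrite ffunE mulrDl.
Qed.
Fact pa_mulDr : right_distributive pa_mul +%R.
Proof.
move=> f g h; apply/ffunP=> p; rewrite !ffunE -big_split /=.
by apply: eq_bigr => qr _; rewrite ffunE mulrDr.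
Qed.
Fact pa_scaleAl (c : k) f g : c *: pa_mul f g = pa_mul (c *: f) g.
Proof.
apply/ffunP=> p; rewrite !ffunE scaler_sumr.
by apply: eq_bigr => qr _; rewrite ffunE; apply: mulrA.
Qed.
Fact pa_scaleAr (c : k) f g : c *: pa_mul f g = pa_mul f (c *: g).
Proof.
apply/ffunP=> p; rewrite !ffunE scaler_sumr.
by apply: eq_bigr => qr _; rewrite ffunE; apply: mulrCA.
Qed.

Lemma pa_mul_path q r :
  pa_mul (pa_path q) (pa_path r) = if pcomp q r is Some p then pa_path p else 0.
Proof.
apply/ffunP=> p; rewrite ffunE.
transitivity ((pcomp q r == Some p)%:R : k).
  rewrite big_mkcond (bigD1 (q, r)) //= !ffunE !eqxx mulr1.
  rewrite big1 ?addr0 => [|[q' r'] /=]; first by case: ifP.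
  rewrite xpair_eqE negb_and !ffunE; case: ifP => // _.
  by case: eqP; case: eqP; rewrite ?mulr0 ?mul0r.
case: (pcomp q r) => [t|]; rewrite !ffunE //=.
by rewrite -(inj_eq (@Some_inj _)) [in RHS]eq_sym.
Qed.

Lemma pa_span f : f = \sum_p (f p : k) *: pa_path p.
Proof.
apply/ffunP=> q; rewrite sum_ffunE (bigD1 q) //= !ffunE eqxx /=.
rewrite big1 ?addr0 => [|p /negPf npq]; first by rewrite [RHS]mulr1.
by rewrite !ffunE eq_sym npq [LHS]mulr0.
Qed.

Lemma pa_mul_suml (I : Type) (s : seq I) (F : I -> PA) g :
  pa_mul (\sum_(i <- s) F i) g = \sum_(i <- s) pa_mul (F i) g.
Proof.
apply: (big_morph (pa_mul^~ g)) => [u v|]; first exact: pa_mulDl.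
by apply: (addrI (pa_mul 0 g)); rewrite -pa_mulDl !addr0.
Qed.

Lemma pa_mul_sumr (I : Type) (s : seq I) (F : I -> PA) f :
  pa_mul f (\sum_(i <- s) F i) = \sum_(i <- s) pa_mul f (F i).
Proof.
apply: (big_morph (pa_mul f)) => [u v|]; first exact: pa_mulDr.
by apply: (addrI (pa_mul f 0)); rewrite -pa_mulDr !addr0.
Qed.

Lemma pa_mul_pathA p q r :
  pa_mul (pa_path p) (pa_mul (pa_path q) (pa_path r)) =
  pa_mul (pa_mul (pa_path p) (pa_path q)) (pa_path r).
Proof.
have mul0r g : pa_mul 0 g = 0.
  by apply: (addrI (pa_mul 0 g)); rewrite -pa_mulDl !addr0.
have mulr0 g : pa_mul g 0 = 0.
  by apply: (addrI (pa_mul g 0)); rewrite -pa_mulDr !addr0.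
have := pcompA p q r; rewrite !pa_mul_path.
by case: (pcomp q r) => [u|]; case: (pcomp p q) => [v|] /=;
  rewrite ?mul0r ?mulr0 ?pa_mul_path // => E; rewrite ?E -?E.
Qed.

Fact pa_mulA : associative pa_mul.
Proof.
move=> f g h.
transitivity (\sum_p \sum_q \sum_r (f p * (g q * h r) : k) *:
    pa_mul (pa_path p) (pa_mul (pa_path q) (pa_path r))).
  rewrite {1}(pa_span f) pa_mul_suml; apply: eq_bigr => p _.
  rewrite {1}(pa_span g) pa_mul_suml pa_mul_sumr; apply: eq_bigr => q _.
  rewrite {1}(pa_span h) !pa_mul_sumr; apply: eq_bigr => r _.
  rewrite -pa_scaleAl -pa_scaleAl -!pa_scaleAr !scalerA; congr (_ *: _).
  by rewrite [RHS]mulrA.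
rewrite {2}(pa_span f) !pa_mul_suml; apply: eq_bigr => p _.
rewrite {2}(pa_span g) !(pa_mul_suml, pa_mul_sumr); apply: eq_bigr => q _.
rewrite {2}(pa_span h) !pa_mul_sumr; apply: eq_bigr => r _.
rewrite pa_mul_pathA -!pa_scaleAl -!pa_scaleAr -!pa_scaleAl !scalerA.
by congr (_ *: _); rewrite -[RHS]mulrA [in RHS](mulrC (h r)).
Qed.

Fact pa_mul1l : left_id pa_one pa_mul.
Proof.
move=> f; rewrite {1}(pa_span f) [RHS]pa_span pa_mul_sumr; apply: eq_bigr => p _.
rewrite -pa_scaleAr; congr (_ *: _); rewrite pa_mul_suml (bigD1 (ptgt p)) //=.
rewrite pa_mul_path big1 ?addr0 => [|i nip]; last first.
  by rewrite pa_mul_path /pcomp /psrc /= eq_sym (negPf nip).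
suff /eqP-> : pcomp (ptriv (ptgt p)) p == Some p by [].
by rewrite pcompP /psrc /ptgt /= !eqxx.
Qed.

Fact pa_mul1r : right_id pa_one pa_mul.
Proof.
move=> f; rewrite {1}(pa_span f) [RHS]pa_span pa_mul_suml; apply: eq_bigr => p _.
rewrite -pa_scaleAl; congr (_ *: _); rewrite pa_mul_sumr (bigD1 (psrc p)) //=.
rewrite pa_mul_path big1 ?addr0 => [|i nip]; last first.
  by rewrite pa_mul_path /pcomp /ptgt /= (negPf nip).
suff /eqP-> : pcomp p (ptriv (psrc p)) == Some p by [].
by rewrite pcompP /psrc /ptgt /= !eqxx.
Qed.
End PathAlgebra.

Section PathFalgebra.
Variables (k : fieldType) (n : nat).
Local Notation PA := (pathalg k n.+1).

Fact pa_one_neq0 : pa_one k n.+1 != 0.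
Proof.
apply/eqP=> /ffunP/(_ (ptriv ord0)); rewrite sum_ffunE (bigD1 ord0) //= !ffunE eqxx.
rewrite big1 => [|i ni]; first by rewrite addr0; apply/eqP/oner_neq0.
rewrite ffunE; case: eqP => // /(congr1 (@psrc _)) /esym/eqP.
by rewrite /psrc /= (negPf ni).
Qed.

HB.instance Definition _ := GRing.Zmodule_isNzRing.Build PA
  (@pa_mulA k n.+1) (@pa_mul1l k n.+1) (@pa_mul1r k n.+1)
  (@pa_mulDl k n.+1) (@pa_mulDr k n.+1) pa_one_neq0.
HB.instance Definition _ := GRing.Lmodule_isLalgebra.Build k PA (@pa_scaleAl k n.+1).
HB.instance Definition _ := GRing.Lalgebra_isAlgebra.Build k PA (@pa_scaleAr k n.+1).
HB.instance Definition _ := Algebra_isFalgebra.Build k PA.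

(* P_i = A e_i, where e_i is the trivial path at the vertex i. *)
Section Projectives.
Variable i : 'I_n.+1.
Definition videm : PA := pa_path k (ptriv i).
Fact Pproj_stable : stable (M := regmod PA) (limg (amulr videm)).
Proof.
move=> b x /memv_imgP[y _ ->]; apply/memv_imgP; exists (b * y).
  exact: memvf.
by rewrite !lfunE /= mulrA.
Qed.
Definition Pproj : fdmod PA := submod Pproj_stable.
End Projectives.

End PathFalgebra.

Arguments Pproj k {n} i.

(* Main.v *)
Require Import Defs.
From mathcomp Require Import all_boot all_order all_algebra all_field zify.

(* T(kA_n) is the symmetric Nakayama algebra with n simples and Loewy length
   n + 1, so an indecomposable module is uniserial, determined by its top
   vertex i and its length l, and the projectives L(P_i) are those of length
   n + 1. A tau-rigid M with projective presentation P1 -d-> P0 -> M has the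
   property that every map P1 -> M factors through d. For two nonprojective
   uniserial summands this forbids the arcs [i, i + l] and [j, j + m] of the
   n-cycle of vertices to cross or to abut (i < j <= i + l < j + m). At most
   n - 1 arcs on n points can satisfy this: each one can be charged to an edge
   of the cycle that belongs to none of the arcs strictly inside it, and the
   edge leaving the end of a longest arc is never used. *)

Set Implicit Arguments.
Unset Strict Implicit.
Unset Printing Implicit Defensive.

Import GRing.Theory.
Local Open Scope ring_scope.

(** * Direct sums and indecomposable modules *)

Section LinearMaps.
Variables (k : fieldType) (V W : vectType k).

(** The uniserial theory sees the algebra only through [nakayama]: any element acts on a homogeneous
    vector as a polynomial in [x], so arguments reduce to counting degrees and vertices modulo N.
    The arc condition is a divisibility: a top vector g of a nonprojective summand of length L
    yields q in P1, at the vertex where its arc ends, with d q = x^L G for a lift G of g. Maps out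
    of P1 can send q to any vector y of M at that vertex, and factoring through d forces y into x^L
    M; the arcs are compared by taking y = x^t h in another summand with generator h. The obstacle
    is to produce maps into a given cyclic module, both here and to show that indecomposables are
    uniserial. One explicit formula, built from a linear functional, serves both times. *)

Lemma inj_lker0 (f : 'Hom(V, W)) : (forall v, f v = 0 -> v = 0) -> lker f == 0%VS.
Proof.
move=> f_inj; apply/lker0P=> u v /eqP; rewrite -subr_eq0 -linearB => /eqP/f_inj/eqP.
by rewrite subr_eq0 => /eqP.
Qed.

Lemma linfun_bij (f : 'Hom(V, W)) :
  (forall v, f v = 0 -> v = 0) -> (forall w, exists v, f v = w) -> bijective f.
Proof.
move=> f_inj f_surj.
have kerf := inj_lker0 f_inj.
exists (f^-1)%VF; first exact: lker0_lfunK.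
by move=> w; have [v <-] := f_surj w; rewrite lker0_lfunK.
Qed.

End LinearMaps.

Section LinearFunctionals.
Variables (k : fieldType) (V : vectType k).

Lemma endo_inj_bij (f : 'End(V)) : (forall v, f v = 0 -> v = 0) -> bijective f.
Proof.
move=> f_inj; apply: linfun_bij => // w.
have kerf := inj_lker0 f_inj.
have /memv_imgP[v _ ->] : w \in limg f; last by exists v.
suff -> : limg f = fullv by exact: memvf.
by apply/eqP; rewrite -(dimv_leqif_eq (subvf _)) limg_dim_eq // (eqP kerf) capv0.
Qed.

Lemma functional_separates (U : {vspace V}) (v : V) : v \notin U ->
  exists2 phi : 'Hom(V, k^o), phi v = 1 & forall u, u \in U -> phi u = 0.
Proof.
move=> Uv.
have v0 : qproj U v != 0 by apply: contra Uv => /eqP/qprojP.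
have [i ci] : exists i, coord (vbasis {:qspace U}) i (qproj U v) != 0.
  apply/existsP; rewrite -negb_forall; apply: contra v0 => /forallP c0.
  rewrite (coord_vbasis (memvf (qproj U v))) big1 // => i _.
  by rewrite (eqP (c0 i)) scale0r.
pose c := coord (vbasis {:qspace U}) i (qproj U v).
pose F u : k^o := c^-1 * coord (vbasis {:qspace U}) i (qproj U u).
have linF : linear F.
  by move=> a u w; rewrite /F !linearP /= mulrDr [a *: _ in RHS]mulrCA.
exists (linfun F); first by rewrite linfun_linearE // /F mulVf.
by move=> u /qprojP u0; rewrite linfun_linearE // /F u0 linear0 mulr0.
Qed.

End LinearFunctionals.

(** [dsums] is an iterated binary sum, so its injections and projections are built by recursion on
    the index, with types depending on it. *)
Lemma ord_dfun m (T : 'I_m.+1 -> Type) (a : T ord0) (b : forall j, T (lift ord0 j)) :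
  exists f : forall i, T i, f ord0 = a /\ forall j, f (lift ord0 j) = b j.
Proof.
pose f i : T i := match unliftP ord0 i with
  | UnliftSome j e => ecast z (T z) (esym e) (b j)
  | UnliftNone e => ecast z (T z) (esym e) a
  end.
exists f; split=> [|j]; rewrite /f.
  case: {-}_ / (unliftP ord0 ord0) => [j e|e]; last by rewrite (eq_axiomK e).
  by have := congr1 val e.
case: {-}_ / (unliftP ord0 (lift ord0 j)) => [j' e|e]; last by have := congr1 val e.
by have ej := lift_inj e; case: j' / ej e => e; rewrite (eq_axiomK e).
Qed.

Section ModuleGenerics.
Variables (k : fieldType) (B : falgType k).
Implicit Types (M N X Y Z P : fdmod B) (a b : B).

Lemma is_hom_id M : is_hom (\1%VF : 'Hom(M, M)).
Proof. by move=> b x; rewrite !id_lfunE. Qed.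

Lemma is_hom_comp M N P (g : 'Hom(N, P)) (f : 'Hom(M, N)) :
  is_hom g -> is_hom f -> is_hom (g \o f)%VF.
Proof. by move=> hg hf b x; rewrite !comp_lfunE hf hg. Qed.

Lemma is_hom_add M N (f g : 'Hom(M, N)) :
  is_hom f -> is_hom g -> is_hom (f + g).
Proof. by move=> hf hg b x; rewrite !add_lfunE hf hg linearD. Qed.

Lemma is_hom_sum M N (I : Type) (r : seq I) (f : I -> 'Hom(M, N)) :
  (forall i, is_hom (f i)) -> is_hom (\sum_(i <- r) f i).
Proof.
move=> hf; elim/big_ind: _ => //; last by move=> *; apply: is_hom_add.
by move=> b x; rewrite !zero_lfunE linear0.
Qed.

Lemma bij_hom_inv M N (f : 'Hom(M, N)) : is_hom f -> bijective f ->
  exists g : 'Hom(N, M), [/\ is_hom g, cancel f g & cancel g f].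
Proof.
move=> hf [h fh hf'].
have kerf : lker f == 0%VS by apply/lker0P; apply: can_inj fh.
have gf : cancel f (f^-1)%VF := lker0_lfunK kerf.
have fg : cancel (f^-1)%VF f by move=> y; rewrite -{1}[y]hf' gf hf'.
by exists (f^-1)%VF; split=> // b y; apply: (can_inj gf); rewrite hf !fg.
Qed.

Lemma iso_sym M N : iso M N -> iso N M.
Proof.
case=> f hf bf; have [g [hg fg gf]] := bij_hom_inv hf bf.
by exists g => //; exists f.
Qed.

Lemma iso_trans M N P : iso M N -> iso N P -> iso M P.
Proof.
move=> [f hf bf] [g hg bg]; exists (g \o f)%VF; first exact: is_hom_comp.
by apply: (@eq_bij _ _ (g \o f)); [exact: bij_comp | move=> x; rewrite comp_lfunE].
Qed.

Section DsumMaps.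
Variables M N : fdmod B.

Definition dsum_fst : 'Hom(dsum M N, M) := linfun (fun z : M * N => z.1).
Definition dsum_snd : 'Hom(dsum M N, N) := linfun (fun z : M * N => z.2).
Definition dsum_inl : 'Hom(M, dsum M N) := linfun (fun x : M => (x, 0) : M * N).
Definition dsum_inr : 'Hom(N, dsum M N) := linfun (fun y : N => (0, y) : M * N).

Lemma dsum_fstE z : dsum_fst z = z.1.
Proof. exact: (@linfun_linearE k (dsum M N) M). Qed.
Lemma dsum_sndE z : dsum_snd z = z.2.
Proof. exact: (@linfun_linearE k (dsum M N) N). Qed.
Lemma dsum_inlE x : dsum_inl x = (x, 0).
Proof.
apply: (@linfun_linearE k M (dsum M N)) => c u v.
by congr (_, _); rewrite /= scaler0 addr0.
Qed.
Lemma dsum_inrE y : dsum_inr y = (0, y).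
Proof.
apply: (@linfun_linearE k N (dsum M N)) => c u v.
by congr (_, _); rewrite /= scaler0 addr0.
Qed.

Lemma dsum_fst_hom : is_hom dsum_fst.
Proof. by move=> b z; rewrite !dsum_fstE. Qed.
Lemma dsum_snd_hom : is_hom dsum_snd.
Proof. by move=> b z; rewrite !dsum_sndE. Qed.
Lemma dsum_inl_hom : is_hom dsum_inl.
Proof. by move=> b z; rewrite !dsum_inlE; congr (_, _); rewrite linear0. Qed.
Lemma dsum_inr_hom : is_hom dsum_inr.
Proof. by move=> b z; rewrite !dsum_inrE; congr (_, _); rewrite linear0. Qed.
End DsumMaps.

Lemma summand_maps X M : is_summand X M ->
  exists (f : 'Hom(X, M)) (g : 'Hom(M, X)),
    [/\ is_hom f, is_hom g & forall x, g (f x) = x].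
Proof.
case=> Y [u hu bu]; have [v [hv uv vu]] := bij_hom_inv hu bu.
exists (v \o dsum_inl X Y)%VF, (dsum_fst X Y \o u)%VF; split.
- exact: is_hom_comp hv (@dsum_inl_hom _ _).
- exact: is_hom_comp (@dsum_fst_hom _ _) hu.
- by move=> x; rewrite !comp_lfunE vu dsum_fstE dsum_inlE.
Qed.

Lemma lker_stable M N (g : 'Hom(M, N)) : is_hom g -> stable (lker g).
Proof. by move=> hg b x; rewrite !memv_ker hg => /eqP ->; rewrite linear0. Qed.

Lemma limg_stable M N (g : 'Hom(M, N)) : is_hom g -> stable (limg g).
Proof.
by move=> hg b _ /memv_imgP[x _ ->]; rewrite -hg; apply/memv_img/memvf.
Qed.

Lemma dsum_submod_iso X M (f : 'Hom(X, M)) (U : {vspace M}) (stU : stable U) :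
  is_hom f -> (forall x, f x \in U -> x = 0) ->
  (forall y, exists x, y - f x \in U) -> iso M (dsum X (submod stU)).
Proof.
move=> hf fU fullU; apply: iso_sym.
pose F (z : dsum X (submod stU)) : M := f z.1 + vsval z.2.
have linF : linear F.
  by move=> c u v; rewrite /F /= linearP scalerDr addrACA.
have FE : linfun F =1 F := linfun_linearE linF.
exists (linfun F).
  by move=> b z; rewrite !FE /F /= hf linearD.
apply: linfun_bij => [[x u] | y].
  rewrite FE /F /= => /eqP; rewrite addr_eq0 => /eqP fx.
  have x0 : x = 0 by apply: fU; rewrite fx memvN subvsP.
  congr (_, _) => //; apply: val_inj => /=; apply: oppr_inj.
  by rewrite -fx x0 linear0 oppr0.
have [x Ux] := fullU y.
exists (x, Subvs Ux); by rewrite FE /F /= addrC subrK.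
Qed.

Lemma maps_summand X M (f : 'Hom(X, M)) (g : 'Hom(M, X)) :
  is_hom f -> is_hom g -> bijective (g \o f)%VF -> is_summand X M.
Proof.
move=> hf hg bgf.
have [h [_ gfh hgf]] := bij_hom_inv (is_hom_comp hg hf) bgf.
exists (submod (lker_stable hg)); apply: (dsum_submod_iso _ hf).
  by move=> x; rewrite memv_ker => /eqP gf0; rewrite -[x]gfh comp_lfunE gf0 linear0.
move=> y; exists (h (g y)); rewrite memv_ker linearB /= -[g (f _)]comp_lfunE hgf.
by rewrite subrr.
Qed.

Lemma is_summand_iso X M N : iso M N -> is_summand X M -> is_summand X N.
Proof. by move=> mn [Y xy]; exists Y; apply: iso_trans (iso_sym mn) xy. Qed.

Lemma is_summand_isol X Y M : iso X Y -> is_summand X M -> is_summand Y M.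
Proof.
case=> u hu bu /summand_maps[f [g [hf hg gf]]].
have [v [hv uv vu]] := bij_hom_inv hu bu.
apply: (@maps_summand _ _ (f \o v)%VF (u \o g)%VF); try exact: is_hom_comp.
by exists id => y; rewrite !comp_lfunE gf vu.
Qed.

Lemma indecomposable_summand X M :
  indecomposable M -> ~ is_zero X -> is_summand X M -> iso X M.
Proof.
move=> [_ indM] nzX [Y xy]; have [//|zY] := indM _ _ xy.
apply: iso_sym; apply: (iso_trans xy).
exists (dsum_fst X Y); first exact: dsum_fst_hom.
exists (dsum_inl X Y) => z; rewrite ?dsum_inlE ?dsum_fstE //=.
by case: z => x y /=; rewrite [y]zY.
Qed.

(* M splits as image + kernel of an iterate f^j having the same rank as f^(2j). *)
Lemma fitting M (f : 'Hom(M, M)) : indecomposable M -> is_hom f ->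
  bijective f \/ exists j, forall x, iter j f x = 0.
Proof.
move=> [_ indM] hf.
pose F j : 'End(M) := iter j (fun g => f \o g)%VF \1%VF.
have FE j x : F j x = iter j f x.
  by elim: j => [|j IH]; rewrite /= ?id_lfunE // comp_lfunE IH.
have hF j : is_hom (F j) by elim: j => [|j IH]; [exact: is_hom_id | exact: is_hom_comp].
have Fadd i j x : F i (F j x) = F (i + j)%N x by rewrite !FE -iterD.
have limgD i j : limg (F (i + j)%N) = (F i @: limg (F j))%VS.
  by rewrite -limg_comp; congr (_ @: fullv)%VS; apply/lfunP => x; rewrite comp_lfunE Fadd.
have [j j_gt0 rkj] :
    exists2 j, (0 < j)%N & \dim (limg (F (j + j)%N)) = \dim (limg (F j)).
  (* The rank bound drops each time doubling j lowers the rank, so the descent stops. Positivity of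
     j is kept so that ker f lies in ker f^j. *)
  have: exists2 j, (0 < j)%N & (\dim (limg (F j)) <= \dim (limg (F 1)))%N by exists 1%N.
  elim/ltn_ind: (\dim (limg (F 1))) => r IH [j j_gt0 rj].
  have: (\dim (limg (F (j + j)%N)) <= \dim (limg (F j)))%N.
    by rewrite limgD -(limg_ker_dim (F j) (limg (F j))) leq_addl.
  rewrite leq_eqVlt => /predU1P[ejj | lt_r]; first by exists j.
  by apply: (IH _ (leq_trans lt_r rj)); exists (j + j)%N => //; rewrite addn_gt0 j_gt0.
have capF : (limg (F j) :&: lker (F j) = 0)%VS.
  apply/eqP; rewrite -dimv_eq0 -(eqn_add2r (\dim (F j @: limg (F j)))).
  by rewrite limg_ker_dim add0n -limgD rkj.
have sumF : (limg (F j) + lker (F j))%VS = fullv.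
  apply/eqP; rewrite -(dimv_leqif_eq (subvf _)) dimv_disjoint_sum //.
  by rewrite addnC -(limg_ker_dim (F j) fullv) capfv.
pose inc : 'Hom(submod (limg_stable (hF j)), M) := linfun vsval.
have incE x : inc x = vsval x by rewrite lfunE.
have capF0 y : y \in limg (F j) -> y \in lker (F j) -> y = 0.
  by move=> y1 y2; apply/eqP; rewrite -memv0 -capF memv_cap y1 y2.
have [zI|zK] : is_zero (submod (limg_stable (hF j))) \/ is_zero (submod (lker_stable (hF j))).
- apply: indM; apply: (@dsum_submod_iso _ _ inc).
  + by move=> b x; rewrite !incE.
  + by move=> x; rewrite incE => /(capF0 _ (subvsP x)) x0; apply: val_inj.
  move=> y; have: y \in (limg (F j) + lker (F j))%VS by rewrite sumF memvf.
  case/memv_addP=> u Uu [v Uv ->]; exists (Subvs Uu).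
  by rewrite incE /= addrC addKr.
- right; exists j => x; rewrite -FE.
  have Fx : F j x \in limg (F j) by apply/memv_img/memvf.
  by have /(congr1 vsval) := zI (Subvs Fx).
left; apply: endo_inj_bij => x fx0.
have Kx : x \in lker (F j).
  by rewrite memv_ker FE -(prednK j_gt0) iterSr fx0 -FE linear0.
by have /(congr1 vsval) := zK (Subvs Kx).
Qed.

(** Let v be the inverse of the total sum. By Fitting, v f_0 is bijective, and then so is f_0, or it
    is nilpotent. In the second case a vector killed by the remaining sum is fixed by v f_0, hence
    zero, and induction applies to that sum. *)
Lemma indecomposable_local M m (f : 'I_m -> 'Hom(M, M)) : indecomposable M ->
  (forall i, is_hom (f i)) -> bijective (\sum_i f i) -> exists i, bijective (f i).
Proof.
move=> indM; elim: m f => [|m IH] f hf.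
  rewrite big_ord0 => -[h fh _]; case: indM.1 => x.
  by apply: (can_inj fh); rewrite !zero_lfunE.
rewrite big_ord_recl => bu; set u := f ord0 + _ in bu.
have hu : is_hom u by apply: is_hom_add => //; apply: is_hom_sum => i.
have [v [hv uv vu]] := bij_hom_inv hu bu.
have [bvf|[j nil_j]] := fitting indM (is_hom_comp hv (hf ord0)).
  exists ord0; apply: (@eq_bij _ _ (u \o (v \o f ord0)%VF)).
    exact: bij_comp.
  by move=> x; rewrite /= comp_lfunE vu.
suff /(IH _ (fun i => hf _))[i bi] : bijective (\sum_i f (lift ord0 i)) by exists (lift ord0 i).
apply: endo_inj_bij => x sx0; rewrite -(nil_j x).
suff e : (v \o f ord0)%VF x = x by elim: j {nil_j} => /= [|j <-]; rewrite ?e.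
by rewrite comp_lfunE -[RHS]uv add_lfunE sx0 addr0.
Qed.

Lemma dsums_maps m (X : 'I_m -> fdmod B) :
  exists (inj : forall i, 'Hom(X i, dsums X)) (prj : forall i, 'Hom(dsums X, X i)),
    [/\ forall i, is_hom (inj i) /\ is_hom (prj i),
        forall i x, prj i (inj i x) = x,
        forall i j x, i != j -> prj j (inj i x) = 0
      & forall y, y = \sum_i inj i (prj i y)].
Proof.
elim: m X => [|m IH] X.
  exists (fun i => 0), (fun i => 0); split; try by case.
  by rewrite /dsums big_ord0 => y; rewrite [y]thinmx0 [RHS]thinmx0.
have [inj [prj [h pi pi0 sum1]]] := IH (fun i => X (lift ord0 i)).
rewrite /dsums big_ord_recl -/(dsums _); set D := dsums _ in inj prj h pi pi0 sum1 *.
have [inj' [inj0 injS]] := ord_dfun (T := fun i => 'Hom(X i, dsum (X ord0) D))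
  (dsum_inl (X ord0) D) (fun j => dsum_inr (X ord0) D \o inj j)%VF.
have [prj' [prj0 prjS]] := ord_dfun (T := fun i => 'Hom(dsum (X ord0) D, X i))
  (dsum_fst (X ord0) D) (fun j => prj j \o dsum_snd (X ord0) D)%VF.
exists inj', prj'; split.
- move=> i; case: (unliftP ord0 i) => [j ->|->].
    rewrite injS prjS; split; apply: is_hom_comp; try exact: (h j).1; try exact: (h j).2.
      exact: dsum_inr_hom.
    exact: dsum_snd_hom.
  by rewrite inj0 prj0; split; [exact: dsum_inl_hom | exact: dsum_fst_hom].
- move=> i; case: (unliftP ord0 i) => [j ->|->] x.
    by rewrite injS prjS !comp_lfunE dsum_inrE dsum_sndE pi.
  by rewrite inj0 prj0 dsum_inlE dsum_fstE.
- move=> i j x; case: (unliftP ord0 i) x => [i' ->|->] x;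
    case: (unliftP ord0 j) => [j' ->|->]; rewrite ?injS ?inj0 ?prjS ?prj0 ?comp_lfunE.
  + by rewrite (inj_eq lift_inj) dsum_inrE dsum_sndE; apply: pi0.
  + by rewrite dsum_inrE dsum_fstE.
  + by rewrite dsum_inlE dsum_sndE linear0.
  + by rewrite eqxx.
move=> [y z]; rewrite big_ord_recl inj0 prj0 dsum_inlE dsum_fstE /=.
transitivity (dsum_inl (X ord0) D y + dsum_inr (X ord0) D z).
  by rewrite dsum_inlE dsum_inrE; congr (_, _); rewrite /= ?addr0 ?add0r.
rewrite dsum_inlE {1}[z]sum1 linear_sum; congr (_ + _); apply: eq_bigr => i _.
by rewrite injS prjS !comp_lfunE dsum_sndE.
Qed.

Lemma is_summand_in_add X M :
  is_summand X M -> in_add X M.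
Proof.
case/summand_maps=> f [g [hf hg gf]]; exists 1%N.
have [inj [prj [h pi _ _]]] := dsums_maps (fun _ : 'I_1 => M).
apply: maps_summand (is_hom_comp (h ord0).1 hf) (is_hom_comp hg (h ord0).2) _.
by exists id => x; rewrite !comp_lfunE pi gf.
Qed.

(** The identity of Y is the sum of its endomorphisms through the [X i]; by locality one of them is
    invertible. *)
Lemma krull_schmidt Y m (X : 'I_m -> fdmod B) : indecomposable Y ->
  is_summand Y (dsums X) -> exists i, is_summand Y (X i).
Proof.
move=> indY /summand_maps[f [g [hf hg gf]]].
have [inj [prj [h _ _ sum1]]] := dsums_maps X.
pose u i : 'Hom(Y, X i) := (prj i \o f)%VF.
pose v i : 'Hom(X i, Y) := (g \o inj i)%VF.
have hu i : is_hom (u i) by apply: is_hom_comp => //; exact: (h i).2.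
have hv i : is_hom (v i) by apply: is_hom_comp => //; exact: (h i).1.
have [|i bi] := indecomposable_local indY (fun i => is_hom_comp (hv i) (hu i)).
  exists id => y; rewrite sum_lfunE -[RHS]gf [X in _ = g X]sum1 linear_sum;
    by apply: eq_bigr => i _; rewrite !comp_lfunE.
by exists i; apply: maps_summand (hu i) (hv i) bi.
Qed.

Lemma basic_num_summands M : basic M ->
  exists m (X : 'I_m -> fdmod B),
    [/\ num_summands M m, forall i, indecomposable (X i), forall i, is_summand (X i) M
      & forall i j, iso (X i) (X j) -> i = j].
Proof.
case=> m [X [indX injX isoM]]; exists m, X.
have sumX i : is_summand (X i) M.
  apply: is_summand_iso (iso_sym isoM) _.
  have [inj [prj [h pi _ _]]] := dsums_maps X.
  apply: maps_summand (h i).1 (h i).2 _.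
  by exists id => y; rewrite comp_lfunE pi.
split=> //; exists X; split=> // Y indY sY.
have [i sYi] := krull_schmidt indY (is_summand_iso isoM sY).
by exists i; apply: indecomposable_summand sYi; [exact: indX | exact: indY.1].
Qed.

Lemma num_summands_ge M m p (Y : 'I_p -> fdmod B) :
  num_summands M m -> (forall i, indecomposable (Y i) /\ is_summand (Y i) M) ->
  (forall i j, iso (Y i) (Y j) -> i = j) -> (p <= m)%N.
Proof.
case=> X [_ _ allX] hY injY.
have /fin_all_exists[s sP] : forall i, exists j, iso (Y i) (X j).
  by move=> i; apply: allX; case: (hY i).
rewrite -[p]card_ord -[m]card_ord; apply: (leq_card s) => i j sij; apply: injY.
by apply: iso_trans (sP i) _; rewrite sij; apply: iso_sym.
Qed.

Lemma num_summands_uniq M m p : num_summands M m -> num_summands M p -> m = p.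
Proof.
move=> mM pM; apply/eqP; rewrite eqn_leq; apply/andP; split.
  by have [X [hX injX _]] := mM; apply: num_summands_ge pM hX injX.
by have [X [hX injX _]] := pM; apply: num_summands_ge mM hX injX.
Qed.

(** A k-basis of P generates it, so P is a retract of a finite power of B; the [g i] are the
    coordinates of a section. Projectivity enters below in this form. *)
Lemma dual_basis P : projective P ->
  exists r (g : 'I_r -> 'Hom(P, regmod B)) (p : 'I_r -> P),
    (forall i, is_hom (g i)) /\ forall y, y = \sum_i lact P (g i y) (p i).
Proof.
move=> projP; pose r := \dim {:P}; pose p (i : 'I_r) : P := (vbasis {:P})`_i.
have [inj [prj [h pi pi0 sum1]]] := dsums_maps (fun _ : 'I_r => regmod B).
pose F (z : dsums (fun _ : 'I_r => regmod B)) := \sum_i lact P (prj i z) (p i).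
have linF : linear F.
  move=> c u v; rewrite /F scaler_sumr -big_split; apply: eq_bigr => i _ /=.
  by rewrite linearP lactDl lactZl.
have FE := linfun_linearE linF.
have hF : is_hom (linfun F).
  move=> b z; rewrite !FE /F linear_sum; apply: eq_bigr => i _.
  by rewrite (h i).2 /= lactM.
have surjF : limg (linfun F) = fullv.
  apply/vspaceP => y; rewrite memvf (coord_vbasis (memvf y)).
  apply: memv_suml => i _; rewrite memvZ //; apply/memv_imgP.
  exists (inj i 1); first exact: memvf.
  rewrite FE /F (bigD1 i) //= pi lact1 big1 ?addr0 // => j ji.
  by rewrite pi0 1?eq_sym // lact0l.
have [s hs sP] := projP _ _ _ _ hF surjF (@is_hom_id P).
exists r, (fun i => (prj i \o s)%VF), p; split=> [i|y].
  by apply: is_hom_comp => //; exact: (h i).2.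
move/lfunP/(_ y): sP; rewrite comp_lfunE id_lfunE FE => {1}<-.
by apply: eq_bigr => i _; rewrite comp_lfunE.
Qed.

End ModuleGenerics.

(** * Tau-rigidity through projective presentations *)

Section OrbitMaps.
Variables (k : fieldType) (B : falgType k).
Implicit Types (M P X : fdmod B) (b : B).

Definition orbit_map M (m : M) : 'Hom(regmod B, M) := linfun (lact M ^~ m).

Lemma orbit_mapE M (m : M) b : orbit_map m b = lact M b m.
Proof. exact: (linfun_linearE (lact_linearl m)). Qed.

Lemma orbit_map_hom M (m : M) : is_hom (orbit_map m).
Proof. by move=> a b; rewrite !orbit_mapE /= lactM. Qed.

(** [u^-1] only picks linear preimages; the condition on annihilators makes the result independent
    of that choice, hence B-linear. *)
Lemma cyclic_hom M X (g : M) (x : X) : (forall y, exists b, y = lact M b g) ->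
  (forall b, lact M b g = 0 -> lact X b x = 0) ->
  exists2 f : 'Hom(M, X), is_hom f & forall b, f (lact M b g) = lact X b x.
Proof.
move=> genM ann; pose u := orbit_map g; pose f := (orbit_map x \o u^-1)%VF.
have fE b : f (lact M b g) = lact X b x.
  rewrite comp_lfunE orbit_mapE; apply/eqP; rewrite -subr_eq0.
  have lactB (Y : fdmod B) (y : Y) a a' : lact Y a y - lact Y a' y = lact Y (a - a') y.
    by rewrite -!orbit_mapE linearB.
  rewrite lactB; apply/eqP/ann; rewrite -lactB -!orbit_mapE -/u.
  by rewrite limg_lfunVK ?subrr // memv_img // memvf.
exists f => // a y; have [b ->] := genM y.
by rewrite -lactM !fE lactM.
Qed.

(* If h : P1 -> M does not factor through d, a functional lambda on Hom(P1, M)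
   that kills Hom(P0, M) d but not h yields the nonzero map
   m |-> (g |-> lambda (g(-) m)) from M to D Tr M. *)
Lemma tau_rigid_factor M : tau_rigid M ->
  exists (P1 P0 : fdmod B) (d : 'Hom(P1, P0)) (e : 'Hom(P0, M)),
    [/\ projective P1 /\ projective P0, is_hom d /\ is_hom e,
        limg e = fullv /\ limg d = lker e
      & forall h : 'Hom(P1, M), is_hom h ->
          exists2 t : 'Hom(P0, M), is_hom t & h = (t \o d)%VF].
Proof.
case=> N [P1 [P0 [d [e [dB [[projP homs img _] isoN]]]]]] rigM.
exists P1, P0, d, e; split=> // h hh.
have [u hu bu] := iso_sym isoN.
have rigM' (f : 'Hom(M, rdual (transpose dB))) : is_hom f -> f = 0.
  move=> hf; have /lfunP uf0 := rigM _ (is_hom_comp hu hf).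
  apply/lfunP => m; apply: (bij_inj bu).
  by have := uf0 m; rewrite comp_lfunE !zero_lfunE linear0.
pose C : 'Hom('Hom(P0, M), 'Hom(P1, M)) := linfun (fun t => (t \o d)%VF).
have CE t : C t = (t \o d)%VF.
  by apply: linfun_linearE => c s t'; rewrite comp_lfunDl comp_lfunZl.
case: (boolP (h \in (C @: homv P0 M)%VS)) => [/memv_imgP[t /homvP ht ->]|].
  by exists t => //; rewrite CE.
case/functional_separates=> lam lam_h lam0.
pose G (g : homr P1) (m : M) : 'Hom(P1, M) := (orbit_map m \o vsval g)%VF.
have GE g m y : G g m y = lact M (vsval g y) m by rewrite comp_lfunE orbit_mapE.
have Glinl m : linear (G ^~ m).
  move=> c g g'; apply/lfunP => y.
  by rewrite !(add_lfunE, scale_lfunE, GE) /= lactDl lactZl.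
have Glinr g : linear (G g).
  move=> c m m'; apply/lfunP => y.
  by rewrite !(add_lfunE, scale_lfunE, GE) linearP.
(* Elements of the image of d^* give maps that factor through d, so lambda descends to the cokernel
   Tr M. *)
have lamG0 g m : g \in limg (homd dB) -> lam (G g m) = 0.
  case/memv_imgP=> g0 _ ->; apply: lam0; apply/memv_imgP.
  have hg0 : is_hom (vsval g0 : 'Hom(P0, regmod B)) by apply/homvP/subvsP.
  exists (orbit_map m \o vsval g0)%VF.
    by apply/homvP/is_hom_comp => //; exact: orbit_map_hom.
  by rewrite CE /G lfunE /= comp_lfunA.
have lamGq g m : lam (G (qrep (qproj (limg (homd dB)) g)) m) = lam (G g m).
  have GB g1 g2 : G g1 m - G g2 m = G (g1 - g2) m.
    by apply/lfunP => y; rewrite !(add_lfunE, opp_lfunE, GE) /= -!orbit_mapE linearB.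
  apply/eqP; rewrite -subr_eq0 -linearB GB; apply/eqP/lamG0/qproj_qrep.
pose f0 (m : M) : rdual (transpose dB) := linfun (fun q => lam (G (qrep q) m)).
have f0E m q : f0 m q = lam (G (qrep q) m).
  by apply: linfun_linearE => c q1 q2; rewrite qrep_is_linear Glinl linearP.
have f0lin : linear f0.
  move=> c m m'; apply/lfunP => q.
  by rewrite !(add_lfunE, scale_lfunE, f0E) Glinr linearP.
have f0hom : is_hom (linfun f0).
  move=> b m; rewrite !(linfun_linearE f0lin); apply/lfunP => q.
  have qb : rmul (transpose dB) b q = qproj (limg (homd dB)) (ract (homr P1) (qrep q) b).
    by rewrite rmulE.
  rewrite /= comp_lfunE f0E qb f0E lamGq; congr (lam _).
  by apply/lfunP => y; rewrite !GE /= comp_lfunE lfunE /= lactM.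
have lamG g m : lam (G g m) = 0.
  have /lfunP/(_ m)/lfunP/(_ (qproj (limg (homd dB)) g)) := rigM' _ f0hom.
  by rewrite (linfun_linearE f0lin) !zero_lfunE f0E lamGq.
(* By the dual basis, h is a sum of maps g(-) m, all of which lambda now kills, although lambda h =
   1. *)
have [r [g [p [hg gp]]]] := dual_basis projP.1.
suff lamh0 : lam h = 0 by have := oner_neq0 k; rewrite -lamh0 lam_h eqxx.
suff -> : h = \sum_i G (Subvs ((homvP _).2 (hg i))) (h (p i)).
  by rewrite linear_sum big1 // => i _; apply: lamG.
apply/lfunP => y; rewrite {1}[y]gp linear_sum sum_lfunE; apply: eq_bigr => i _.
by rewrite GE /= hh.
Qed.

End OrbitMaps.

(** * Uniserial modules over a Nakayama algebra *)

(* A presentation of the symmetric Nakayama algebra with N = n + 1 simples and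
   Loewy length N + 1: x is the sum of the arrows of the cyclic quiver, and
   the idempotents e i are indexed by nat, periodically modulo N. *)
Record nakayama (k : fieldType) (B : falgType k) (n : nat) (e : nat -> B) (x : B) :
    Prop := Nakayama {
  nak_orth : forall i j, e i * e j = if i == j %[mod n.+1] then e j else 0;
  nak_sum : \sum_(i < n.+1) e i = 1;
  nak_comm : forall i, x * e i = e i.+1 * x;
  nak_nil : x ^+ n.+2 = 0;
  nak_socle : forall i, x ^+ n.+1 * e i != 0;
  nak_span : forall b, exists c : nat -> nat -> k,
    b = \sum_(t < n.+2) \sum_(i < n.+1) c t i *: (x ^+ t * e i) }.

Section NakayamaModules.
Variables (k : fieldType) (B : falgType k) (n : nat) (e : nat -> B) (x : B).
Hypothesis nakB : nakayama n e x.
Implicit Types (M X Y P : fdmod B) (i j l s t : nat).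

Lemma lactX_add M s t (y : M) :
  lact M (x ^+ (s + t)) y = lact M (x ^+ s) (lact M (x ^+ t) y).
Proof. by rewrite exprD lactM. Qed.

Lemma lactX_eq0 M s t (y : M) :
  (s <= t)%N -> lact M (x ^+ s) y = 0 -> lact M (x ^+ t) y = 0.
Proof. by move=> /subnK <- y0; rewrite lactX_add y0 linear0. Qed.

Lemma lactX_large M t (y : M) : (n.+1 < t)%N -> lact M (x ^+ t) y = 0.
Proof. by move/lactX_eq0; apply; rewrite (nak_nil nakB) lact0l. Qed.

Lemma nak_commX t i : x ^+ t * e i = e (i + t)%N * x ^+ t.
Proof.
elim: t i => [|t IH] i; first by rewrite !expr0 mul1r mulr1 addn0.
by rewrite exprS -mulrA IH !mulrA (nak_comm nakB) addnS.
Qed.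

Lemma nak_idem i : e i * e i = e i. Proof. by rewrite (nak_orth nakB) eqxx. Qed.

Lemma nak_mod i j : i = j %[mod n.+1] -> e i = e j.
Proof.
move=> eij; suff eE s : e s = e (s %% n.+1)%N by rewrite eE eij -eE.
rewrite -[LHS]mulr1 -(nak_sum nakB) mulr_sumr.
rewrite (bigD1 (Ordinal (ltn_pmod s (ltn0Sn n)))) //= (nak_orth nakB) modn_mod eqxx.
rewrite big1 ?addr0 // => a; rewrite -val_eqE /= => /negPf ns.
by rewrite (nak_orth nakB) (modn_small (ltn_ord a)) eq_sym ns.
Qed.

Lemma homog_lactX M i t (g : M) : lact M (e i) g = g ->
  lact M (e (i + t)%N) (lact M (x ^+ t) g) = lact M (x ^+ t) g.
Proof. by move=> eg; rewrite -lactM -nak_commX lactM eg. Qed.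

Lemma lact_homog M i j (g : M) : lact M (e i) g = g ->
  lact M (e j) g = if j == i %[mod n.+1] then g else 0.
Proof.
move=> eg; rewrite -{1}eg -lactM (nak_orth nakB).
by case: ifP => _; rewrite ?eg ?lact0l.
Qed.

Lemma lact_nak_sum M (y : M) (c : nat -> nat -> k) :
  lact M (\sum_(t < n.+2) \sum_(i < n.+1) c t i *: (x ^+ t * e i)) y =
  \sum_(t < n.+2) \sum_(i < n.+1) c t i *: lact M (x ^+ t) (lact M (e i) y).
Proof.
rewrite -orbit_mapE linear_sum; apply: eq_bigr => t _.
rewrite linear_sum; apply: eq_bigr => i _.
by rewrite linearZ /= orbit_mapE lactM.
Qed.

(** The coefficients are chosen before the module, so that the same ones serve for two modules at
    once. *)
Lemma lact_on_homog b i : exists c : nat -> k, forall M (g : M),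
  lact M (e i) g = g -> lact M b g = \sum_(t < n.+2) c t *: lact M (x ^+ t) g.
Proof.
have [c bE] := nak_span nakB b; exists (fun t => c t (i %% n.+1)%N) => M g eg.
rewrite {1}bE lact_nak_sum; apply: eq_bigr => t _.
rewrite (bigD1 (Ordinal (ltn_pmod i (ltn0Sn n)))) //= (lact_homog _ eg).
rewrite modn_mod eqxx big1 ?addr0 // => j; rewrite -val_eqE /= => /negPf ns.
by rewrite (lact_homog _ eg) (modn_small (ltn_ord j)) ns linear0 scaler0.
Qed.

Lemma lactX_coef0 M l s r (g : M) (c : nat -> k) :
  lact M (x ^+ l) g != 0 -> lact M (x ^+ l.+1) g = 0 ->
  \sum_(t < r) c t *: lact M (x ^+ (t + s)) g = 0 ->
  forall t, (t < r)%N -> (t + s <= l)%N -> c t = 0.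
Proof.
move=> gl gl1 sum0 t; elim/ltn_ind: t => t IH lt_tr le_tl.
move/(congr1 (lact M (x ^+ (l - (t + s))))): sum0.
rewrite linear0 linear_sum (bigD1 (Ordinal lt_tr)) //= linearZ /= -lactX_add subnK //.
rewrite big1 ?addr0 => [/eqP|j].
  by rewrite scaler_eq0 (negPf gl) orbF => /eqP.
rewrite -val_eqE /= neq_ltn linearZ /= => /orP[lt_jt|lt_tj].
  by rewrite IH ?scale0r // (leq_trans _ le_tl) // leq_add2r ltnW.
rewrite -lactX_add (lactX_eq0 _ gl1) ?scaler0 //.
by clear -le_tl lt_tj; lia.
Qed.

(* M is uniserial with top at the vertex i and of length l + 1. *)
Definition uniserial M i l (g : M) : Prop :=
  [/\ lact M (e i) g = g, lact M (x ^+ l) g != 0, lact M (x ^+ l.+1) g = 0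
    & forall y, exists b, y = lact M b g].

Lemma uniserial_length M i l (g : M) : uniserial i l g -> (l <= n.+1)%N.
Proof. by case=> _ gl _ _; rewrite leqNgt; apply: contra gl => /lactX_large ->. Qed.

Lemma uniserial_nil M i l (g y : M) : uniserial i l g -> lact M (x ^+ l.+1) y = 0.
Proof.
case=> eg _ gl1 genM; have [b ->] := genM y; have [c ->] // := lact_on_homog b i.
rewrite linear_sum big1 // => t _.
by rewrite linearZ /= -lactX_add addnC lactX_add gl1 linear0 scaler0.
Qed.

(** If b kills g, the coefficients of b in degrees up to l vanish, and the higher powers of x kill
    h. *)
Lemma ann_transfer M Y i l b (g : M) (h : Y) :
  lact M (e i) g = g -> lact M (x ^+ l) g != 0 -> lact M (x ^+ l.+1) g = 0 ->
  lact Y (e i) h = h -> lact Y (x ^+ l.+1) h = 0 ->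
  lact M b g = 0 -> lact Y b h = 0.
Proof.
move=> eg gl gl1 eh hl1; have [c bE] := lact_on_homog b i; rewrite !bE // => sum0.
rewrite big1 // => t _; case: (leqP t l) => [le_tl|lt_lt]; last first.
  by rewrite (lactX_eq0 lt_lt hl1) scaler0.
rewrite (@lactX_coef0 _ l 0 n.+2 g c) ?scale0r ?addn0 //.
by rewrite -[RHS]sum0; apply: eq_bigr => j _; rewrite addn0.
Qed.

Lemma uniserial_hom M Y i l (g : M) (h : Y) : uniserial i l g ->
  lact Y (e i) h = h -> lact Y (x ^+ l.+1) h = 0 ->
  exists2 f : 'Hom(M, Y), is_hom f & forall b, f (lact M b g) = lact Y b h.
Proof.
move=> [eg gl gl1 genM] eh hl1; apply: cyclic_hom => // b; exact: (ann_transfer eg gl gl1 eh hl1).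
Qed.

Lemma uniserial_iso M Y i l (g : M) (h : Y) :
  uniserial i l g -> uniserial i l h -> iso M Y.
Proof.
move=> ug uh; have [[eg _ gl1 genM] [eh _ hl1 genY]] := (ug, uh).
have [f hf fE] := uniserial_hom ug eh hl1.
have [f' _ f'E] := uniserial_hom uh eg gl1.
exists f => //; exists f' => y; first by have [b ->] := genM y; rewrite fE f'E.
by have [b ->] := genY y; rewrite f'E fE.
Qed.

(** Multiplication by x^(l - t), where t is the lowest degree with nonzero coefficient in y, leaves
    a nonzero multiple of x^l g. Hence every nonzero submodule contains this vector. *)
Lemma uniserial_socle M i l (g y : M) : uniserial i l g -> y != 0 ->
  exists b, lact M b y = lact M (x ^+ l) g.
Proof.
move=> [eg gl gl1 genM]; have [b yE] := genM y; have [c bE] := lact_on_homog b i.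
rewrite yE bE //; case: (boolP [exists t : 'I_n.+2, (t <= l)%N && (c t != 0)]).
  case/existsP=> t0 ct0 _.
  have [|t /andP[le_tl ct] tmin] := @ex_minnP (fun t => (t <= l)%N && (c t != 0)).
    by exists t0.
  have lt_t : (t < n.+2)%N by apply: leq_ltn_trans (tmin _ ct0) (ltn_ord t0).
  exists ((c t)^-1 *: x ^+ (l - t)).
  rewrite lactZl linear_sum (bigD1 (Ordinal lt_t)) //= linearZ /= -lactX_add subnK //.
  rewrite big1 ?addr0 ?scalerA ?mulVf ?scale1r // => j; rewrite -val_eqE /= => nj.
  rewrite linearZ /= -lactX_add; case: (ltnP j t) => [lt_jt|].
    have : ~~ ((j <= l)%N && (c j != 0)) by apply: contraL lt_jt => /tmin; rewrite -leqNgt.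
    by rewrite (ltnW (leq_trans lt_jt le_tl)) negbK => /eqP ->; rewrite scale0r.
  rewrite leq_eqVlt eq_sym (negPf nj) /= => lt_tj.
  by rewrite (lactX_eq0 _ gl1) ?scaler0 //; lia.
move/existsPn=> c0 /eqP[]; rewrite big1 // => t _.
have := c0 t; rewrite negb_and -ltnNge negbK => /orP[lt_lt|/eqP ->]; last by rewrite scale0r.
by rewrite (lactX_eq0 lt_lt gl1) scaler0.
Qed.

(** Two complementary nonzero submodules would both contain the socle vector x^l g. *)
Lemma uniserial_indecomposable M i l (g : M) : uniserial i l g -> indecomposable M.
Proof.
move=> ug; have [eg gl gl1 genM] := ug; split=> [zM|X Y [u hu bu]].
  by rewrite (zM (lact M _ g)) eqxx in gl.
have [v [hv uv vu]] := bij_hom_inv hu bu.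
have socP (z : dsum X Y) : z != 0 -> exists b, lact (dsum X Y) b z = u (lact M (x ^+ l) g).
  move=> z0; have vz0 : v z != 0.
    by apply: contra z0 => /eqP vz0; rewrite -[z]vu vz0 linear0.
  by have [b bz] := uniserial_socle ug vz0; exists b; rewrite -bz hu vu.
case: (eqVneq (u (lact M (x ^+ l) g)).1 0) => [u1|u1]; last first.
  right=> y; apply/eqP/negPn/negP => y0.
  have [|b /(congr1 fst) /= bz] := socP (0, y); first by rewrite xpair_eqE negb_and y0 orbT.
  by rewrite -bz linear0 eqxx in u1.
left=> y; apply/eqP/negPn/negP => y0.
have [|b /(congr1 snd) /= bz] := socP (y, 0); first by rewrite xpair_eqE negb_and y0.
case/eqP: gl; rewrite -[LHS]uv (_ : u _ = 0) ?linear0 //.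
by apply: injective_projections; rewrite ?u1 // -bz linear0.
Qed.

(** At maximal length the socle lies at i + n + 1, the same vertex as the top, and an isomorphism
    sends x^(n+1) g to a nonzero multiple of x^(n+1) h. This separates the L(P_i). *)
Lemma uniserial_max_top M Y i j (g : M) (h : Y) :
  uniserial i n.+1 g -> uniserial j n.+1 h -> iso M Y -> i = j %[mod n.+1].
Proof.
move=> [eg gN _ _] [eh _ _ genY] [u hu bu]; have [v [_ uv _]] := bij_hom_inv hu bu.
have eug : lact Y (e i) (u g) = u g by rewrite -hu eg.
have [b bE] := genY (u g); have [c cE] := lact_on_homog b j.
have ugN : lact Y (x ^+ n.+1) (u g) = c 0%N *: lact Y (x ^+ n.+1) h.
  rewrite bE cE // linear_sum big_ord_recl linearZ /= expr0 lact1 big1 ?addr0 // => t _.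
  by rewrite linearZ /= -lactX_add lactX_large ?scaler0 // /bump; lia.
have := homog_lactX n.+1 eug; rewrite ugN linearZ /=.
rewrite (lact_homog _ (homog_lactX n.+1 eh)) eqn_modDr; case: eqP => // _.
rewrite scaler0 -ugN -hu => uxg0; case/eqP: gN.
by apply: (can_inj uv); rewrite -uxg0 linear0.
Qed.

Lemma gen_hom M Y (f : 'Hom(M, Y)) :
  (forall j y, f (lact M (e j) y) = lact Y (e j) (f y)) ->
  (forall y, f (lact M x y) = lact Y x (f y)) -> is_hom f.
Proof.
move=> fe fx b y; have [c ->] := nak_span nakB b.
have fX t z : f (lact M (x ^+ t) z) = lact Y (x ^+ t) (f z).
  elim: t z => [|t IH] z; first by rewrite !expr0 !lact1.
  by rewrite !exprS !lactM fx IH.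
rewrite !lact_nak_sum linear_sum; apply: eq_bigr => t _; rewrite linear_sum.
by apply: eq_bigr => i _; rewrite linearZ /= fX fe.
Qed.

(* A homogeneous functional on M yields a map into any cyclic module Bh: the
   self-injectivity of B, made explicit and truncated at x ^ (l + 1) = 0. *)
Lemma functional_hom M Y l s (phi : 'Hom(M, k^o)) (h : Y) :
  (forall y, lact M (x ^+ l.+1) y = 0) ->
  lact Y (e s) h = h -> lact Y (x ^+ l.+1) h = 0 ->
  (forall y, phi (lact M (e (s + l)%N) y) = phi y) ->
  exists2 r : 'Hom(M, Y), is_hom r & forall y,
    r y = \sum_(t < l.+1) (phi (lact M (x ^+ (l - t)) y) : k) *: lact Y (x ^+ t) h.
Proof.
move=> nilM eh hl1 phie.
pose F y : Y := \sum_(t < l.+1) (phi (lact M (x ^+ (l - t)) y) : k) *: lact Y (x ^+ t) h.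
have linF : linear F.
  move=> c y z; rewrite /F scaler_sumr -big_split; apply: eq_bigr => t _ /=.
  by rewrite !linearP /= scalerDl scalerA.
exists (linfun F); last exact: linfun_linearE.
apply: gen_hom => [j y|y]; rewrite !(linfun_linearE linF) /F linear_sum /=.
  apply: eq_bigr => t _; rewrite linearZ /= (lact_homog _ (homog_lactX t eh)).
  have sl : (s + l = s + t + (l - t))%N by rewrite -addnA subnKC // -ltnS.
  rewrite -lactM nak_commX lactM -[RHS]/(_ *: _) -phie -lactM (nak_orth nakB).
  have -> : (s + l == j + (l - t) %[mod n.+1]) = (j == s + t %[mod n.+1]).
    by rewrite sl eqn_modDr eq_sym.
  case: eqP => [ejs|_]; last by rewrite lact0l linear0 scale0r scaler0.
  congr (_ *: _); rewrite (@nak_mod (j + (l - t)) (s + l)) ?phie //.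
  by rewrite sl; apply/eqP; rewrite eqn_modDr ejs.
(* The two sums agree after a shift of the index: the first term on the left contains x^(l+1) y = 0,
   the last on the right x^(l+1) h = 0. *)
rewrite big_ord_recl big_ord_recr /= subn0 -lactM -exprSr nilM linear0 scale0r add0r.
rewrite linearZ /= -lactM -exprS hl1 scaler0 addr0; apply: eq_bigr => t _.
rewrite linearZ /= -!lactM -exprSr -exprS subnSK //.
Qed.

(** Take l maximal with x^l nonzero on M and a homogeneous g with z = x^l g nonzero. A functional
    equal to 1 on z gives an endomorphism r with image in Bg and r z = z. It is not nilpotent, so by
    Fitting it is onto and M = Bg. *)
Lemma indecomposable_uniserial M : indecomposable M ->
  exists (i : 'I_n.+1) l (g : M), uniserial i l g.
Proof.
move=> indM; have [nzM _] := indM.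
have [|l1 /eqP xl1 minl1] := @ex_minnP (fun t => lmul M (x ^+ t) == 0).
  by exists n.+2; apply/eqP/lfunP => y; rewrite lmulE zero_lfunE lactX_large.
have nilM y : lact M (x ^+ l1) y = 0 by rewrite -lmulE xl1 zero_lfunE.
case: l1 xl1 minl1 nilM => [|l] xl1 minl nilM.
  by case: nzM => y; rewrite -(nilM y) expr0 lact1.
have xl : lmul M (x ^+ l) != 0 by apply/negP => /minl; rewrite ltnn.
have [y xly] : exists y, lact M (x ^+ l) y != 0.
  have /memv_imgP[y _ yE] := memv_pick (limg (lmul M (x ^+ l))).
  exists y; rewrite -lmulE -yE vpick0; apply: contra xl => /eqP im0.
  apply/eqP/lfunP => z; rewrite zero_lfunE; apply/eqP.
  by rewrite -memv0 -im0 memv_img // memvf.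
have [i xlg] : exists i : 'I_n.+1, lact M (x ^+ l) (lact M (e i) y) != 0.
  apply/existsP; rewrite -negb_forall; apply: contra xly => /forallP xle.
  rewrite -[y]lact1 -[lact M 1 y]orbit_mapE -(nak_sum nakB) !linear_sum big1 // => i _.
  by rewrite /= orbit_mapE (eqP (xle i)).
set g := lact M (e i) y in xlg; exists i, l, g.
have eg : lact M (e i) g = g by rewrite -lactM nak_idem.
pose z := lact M (x ^+ l) g.
have z0 : z \notin 0%VS by rewrite memv0.
have [phi phi_z _] := functional_separates z0.
pose psi : 'Hom(M, k^o) := (phi \o lmul M (e (i + l)%N))%VF.
have psiE w : psi w = phi (lact M (e (i + l)%N) w) by rewrite comp_lfunE lmulE.
have [|r hr rE] := functional_hom nilM eg (nilM g) (phi := psi).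
  by move=> w; rewrite !psiE -lactM nak_idem.
have rz : r z = z.
  rewrite rE big_ord_recr /= big1 => [|t _].
    by rewrite subnn expr0 lact1 psiE homog_lactX // phi_z scale1r add0r.
  rewrite -lactX_add (@lactX_eq0 _ l.+1) ?linear0 ?scale0r //.
  by have := ltn_ord t; lia.
split=> // w; have [[h _ rh]|[j /(_ z)]] := fitting indM hr.
  rewrite -[w]rh rE.
  exists (\sum_(t < l.+1) (psi (lact M (x ^+ (l - t)) (h w)) : k) *: x ^+ t).
  by rewrite -orbit_mapE linear_sum; apply: eq_bigr => t _; rewrite linearZ /= orbit_mapE.
suff -> : iter j r z = z by move=> z1; rewrite -/z z1 eqxx in xlg.
by elim: j => //= j ->.
Qed.

(** Each B e_i has basis x^t e_i with t <= n + 1, so x^s b = 0 leaves only terms of degree at least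
    r = n + 2 - s. *)
Lemma regmod_lactX_exact s r (b : regmod B) : (s + r = n.+2)%N ->
  lact (regmod B) (x ^+ s) b = 0 -> exists a, b = x ^+ r * a.
Proof.
move=> sr xb.
suff /fin_all_exists[a aE] : forall i : 'I_n.+1, exists a, b * e i = x ^+ r * a.
  exists (\sum_i a i); rewrite mulr_sumr -[LHS]mulr1 -(nak_sum nakB) mulr_sumr.
  by apply: eq_bigr => i _; apply: aE.
move=> i; have [c bE] := lact_on_homog b i.
have ei : lact (regmod B) (e i) (e i) = e i by apply: nak_idem.
have bei : b * e i = \sum_(t < n.+2) c t *: (x ^+ t * e i) := bE _ _ ei.
have c0 t : (t < r)%N -> c t = 0.
  move=> lt_tr; apply: (@lactX_coef0 (regmod B) n.+1 s n.+2 (e i) c).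
  - exact: (nak_socle nakB).
  - exact: lactX_large.
  - have : x ^+ s * (b * e i) = 0 by rewrite mulrA [x ^+ s * b]xb mul0r.
    rewrite bei mulr_sumr => e0; rewrite -[RHS]e0; apply: eq_bigr => t' _.
    by rewrite /= -scalerAr mulrA -exprD addnC.
  - by lia.
  - by lia.
exists (\sum_(t < n.+2) c t *: (x ^+ (t - r) * e i)).
rewrite bei mulr_sumr; apply: eq_bigr => t _; case: (ltnP t r) => [/c0 ->|le_rt].
  by rewrite !scale0r mulr0.
by rewrite -scalerAr mulrA -exprD subnKC.
Qed.

Lemma projective_lactX_exact P s r (y : P) : projective P -> (s + r = n.+2)%N ->
  lact P (x ^+ s) y = 0 -> exists z, y = lact P (x ^+ r) z.
Proof.
move=> projP sr xy; have [m [g [p [hg gp]]]] := dual_basis projP.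
have /fin_all_exists[a aE] : forall i : 'I_m, exists a : B, g i y = x ^+ r * a.
  by move=> i; apply: (regmod_lactX_exact sr); rewrite -hg xy linear0.
exists (\sum_i lact P (a i) (p i)); rewrite {1}[y]gp linear_sum.
by apply: eq_bigr => i _; rewrite aE lactM.
Qed.

(* Lift g to P0; then x^(l+1) kills it modulo d q for some q in P1, and
   x^(n+1) q <> 0, so that Bq is an injective summand of P1 on which maps to M
   can be prescribed; they factor through d. *)
Lemma tau_rigid_lactX M i l (g y : M) : tau_rigid M ->
  lact M (e i) g = g -> lact M (x ^+ l.+1) g = 0 ->
  (forall w, lact M (x ^+ l) g <> lact M (x ^+ n.+1) w) ->
  lact M (e (i + l.+1)%N) y = y -> exists z, y = lact M (x ^+ l.+1) z.
Proof.
case/tau_rigid_factor=> P1 [P0 [d [p [[pP1 pP0] [hd hp] [surjp img] fac]]]].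
move=> eg gl1 gN ey.
have [G eG pG] : exists2 G, lact P0 (e i) G = G & p G = g.
  have /memv_imgP[G _ gE] : g \in limg p by rewrite surjp memvf.
  by exists (lact P0 (e i) G); rewrite -?lactM ?nak_idem // hp -gE.
have [q eq dq] : exists2 q, lact P1 (e (i + l.+1)%N) q = q & d q = lact P0 (x ^+ l.+1) G.
  have /memv_imgP[q _ qE] : lact P0 (x ^+ l.+1) G \in limg d.
    by rewrite img memv_ker hp pG gl1.
  exists (lact P1 (e (i + l.+1)%N) q); first by rewrite -lactM nak_idem.
  by rewrite hd -qE homog_lactX.
(* Otherwise q = x q', and x kills x^l G - d q', which then lies in x^(n+1) P0. Applying p puts x^l
   g in x^(n+1) M, against the hypothesis. *)
have qN : lact P1 (x ^+ n.+1) q != 0.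
  apply/eqP => /(projective_lactX_exact (r := 1) pP1)[|q' q'E]; first by rewrite addn1.
  have : lact P0 (x ^+ 1) (lact P0 (x ^+ l) G - d q') = 0.
    by rewrite linearB /= -lactX_add add1n -dq q'E hd subrr.
  case/(projective_lactX_exact (r := n.+1) pP0) => // w wE.
  apply: (gN (p w)); rewrite -hp -wE linearB /= hp pG.
  suff -> : p (d q') = 0 by rewrite subr0.
  by apply/eqP; rewrite -memv_ker -img memv_img // memvf.
have qN0 : lact P1 (x ^+ n.+1) q \notin 0%VS by rewrite memv0.
have [phi phi_q _] := functional_separates qN0.
pose j := (i + l.+1 + n.+1)%N.
pose psi : 'Hom(P1, k^o) := (phi \o lmul P1 (e j))%VF.
have psiE w : psi w = phi (lact P1 (e j) w) by rewrite comp_lfunE lmulE.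
(* q and x^(n+1) q lie at the same vertex, so psi may be nonzero on both and r q = h + psi(q)
   x^(n+1) h. The correction in h makes this equal to y. *)
pose h := y - (psi q : k) *: lact M (x ^+ n.+1) y.
have eh : lact M (e (i + l.+1)%N) h = h.
  rewrite linearB linearZ /= ey; congr (_ - _ *: _).
  by rewrite (@nak_mod (i + l.+1) j) ?homog_lactX // modnDr.
have [||r hr rE] := functional_hom (fun w => lactX_large w (ltnSn _)) eh _ (phi := psi).
- exact: lactX_large.
- by move=> w; rewrite !psiE -lactM nak_idem.
have [t ht rt] := fac r hr.
exists (t G); rewrite -ht -dq -comp_lfunE -rt rE.
rewrite big_ord_recl big_ord_recr /= subnn subn0 !expr0 !lact1 big1 => [|s _].
  have -> : psi (lact P1 (x ^+ n.+1) q) = 1 by rewrite psiE /j homog_lactX.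
  rewrite scale1r add0r {2}/h linearB linearZ /= -lactX_add.
  rewrite /bump add1n [X in _ - _ *: X]lactX_large; last by lia.
  by rewrite scaler0 subr0 /h subrK.
rewrite psiE (lact_homog _ (homog_lactX _ eq)) /j eqn_modDl /bump /=.
have := ltn_ord s; set r' := (n.+1 - _)%N => ltsn.
rewrite modnn (modn_small (m := r')) /r'; last by lia.
by case: eqP => [|_]; [lia | rewrite linear0 scale0r].
Qed.

(** The vector x^t h lies where the arc of X ends, hence in x^(l+1) M. If t <= l, multiplying by
    x^(m - t) and retracting onto Y puts x^m h in x^(m+1) Y = 0. *)
Lemma tau_rigid_uniserials M X Y i j l m t (g : X) (h : Y) : tau_rigid M ->
  is_summand X M -> is_summand Y M -> uniserial i l g -> uniserial j m h ->
  (l <= n)%N -> (t <= m)%N -> i + l.+1 = j + t %[mod n.+1] -> (l < t)%N.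
Proof.
move=> rigM /summand_maps[f [f' [hf hf' ff']]] /summand_maps[u [u' [hu hu' uu']]].
move=> ug uh le_ln le_tm ijt.
have [[eg gl gl1 _] [eh hm hm1 _]] := (ug, uh).
have eth : lact M (e (i + l.+1)%N) (u (lact Y (x ^+ t) h)) = u (lact Y (x ^+ t) h).
  by rewrite -hu (nak_mod ijt) homog_lactX.
have [||w|z zE] := tau_rigid_lactX (g := f g) rigM _ _ _ eth.
- by rewrite -hf eg.
- by rewrite -hf gl1 linear0.
(* Here X is nonprojective: since l <= n, x^(n+1) kills X, while x^l g is nonzero. *)
- rewrite -hf => /(congr1 f'); rewrite ff' hf'.
  by rewrite (lactX_eq0 _ (uniserial_nil (f' w) ug)) // => gl0; rewrite gl0 eqxx in gl.
rewrite ltnNge; apply: contra hm => le_tl.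
rewrite -(subnK le_tm) lactX_add -[lact Y (x ^+ t) h]uu' zE hu' -lactX_add.
by rewrite (lactX_eq0 _ (uniserial_nil (u' z) uh)) //; lia.
Qed.

End NakayamaModules.

(** * Noncrossing arcs *)

Section Arcs.
Local Open Scope nat_scope.

(* The arc of index i goes clockwise from the vertex a i of the (n+1)-gon to
   a i + l i. Arc j is sent to the edge leaving the end of the longest strictly
   shorter arc with the same origin (leaving a j if there is none). *)
Lemma noncrossing_arcs_bound n m (a l : 'I_m -> nat) :
  (forall i, a i < n.+1) -> (forall i, 0 < l i) ->
  (forall i j t, t < l j -> a i + l i = a j + t %[mod n.+1] -> l i <= t) ->
  (forall i j, a i = a j -> l i = l j -> i = j) -> m <= n.
Proof.
case: m a l => // m a l a_lt l_gt0 noncross inj_al.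
pose p j := \max_(i | (a i == a j) && (l i < l j)) l i.
have p_lt j : p j < l j.
  by rewrite -(prednK (l_gt0 j)) ltnS; apply/bigmax_leqP => i /andP[_]; lia.
have p_max i j : a i = a j -> l i < l j -> l i <= p j.
  move=> eq_a lt_l; apply: (@leq_bigmax_cond _ (fun i => (a i == a j) && (l i < l j)) l).
  by rewrite eq_a eqxx.
have p_arc j : 0 < p j -> exists2 i, a i = a j & l i = p j.
  move=> pj; case: (pickP (fun i => (a i == a j) && (l i < l j))) => [i Pi|none].
    have [|i0 /andP[/eqP ai0 _] li0] := @eq_bigmax_cond _ (fun i => (a i == a j) && (l i < l j)) l.
      by apply/card_gt0P; exists i.
    by exists i0.
  by move: pj; rewrite /p big_pred0.
pose f j : 'I_n.+1 := Ordinal (ltn_pmod (a j + p j) (ltn0Sn n)).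
(* If p i < p j, the arc realising p j ends at distance p i from a i, strictly before the end of arc
   i, so noncrossing bounds its length p j by p i. *)
have p_le i j : f i = f j -> p j <= p i.
  move/(congr1 val) => /= fij; rewrite leqNgt; apply/negP => lt_p.
  have [|j' aj' lj'] := p_arc j; first by apply: leq_trans lt_p.
  by have := noncross j' i (p i) (p_lt i); rewrite aj' lj' fij leqNgt lt_p => /(_ erefl).
have inj_f : injective f.
  move=> i j fij; have eq_p : p i = p j by apply/eqP; rewrite eqn_leq !p_le.
  have eq_a : a i = a j.
    move/(congr1 val): fij => /= /eqP; rewrite eq_p eqn_modDr.
    by rewrite !modn_small // => /eqP.
  apply: inj_al => //; case: (ltngtP (l i) (l j)) => // lt_l.
    by have := p_max _ _ eq_a lt_l; rewrite -eq_p leqNgt p_lt.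
  by have := p_max _ _ (esym eq_a) lt_l; rewrite eq_p leqNgt p_lt.
(* If f j were the end of a longest arc i, noncrossing would give l i <= p j < l j. *)
have [i _ l_max] := @arg_maxnP _ ord0 predT l isT.
pose b : 'I_n.+1 := Ordinal (ltn_pmod (a i + l i) (ltn0Sn n)).
have f_b j : f j != b.
  apply/eqP => /(congr1 val) /= fjb.
  have := noncross i j (p j) (p_lt j) (esym fjb).
  by rewrite leqNgt (leq_trans (p_lt j) (l_max j isT)).
rewrite -[m.+1]card_ord -(card_codom inj_f) -[n]/(n.+1.-1) -[in leqRHS](card_ord n.+1) -(cardC1 b).
by apply/subset_leq_card/subsetP => _ /codomP[j ->]; apply: f_b.
Qed.

End Arcs.

(** * The trivial extension of the path algebra *)

Section TrivialExtensionPairs.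
Variables (k : fieldType) (A : falgType k).

Lemma te_inlZ (c : k) (a : A) : c *: ((a, 0) : trivext A) = (c *: a, 0).
Proof. by congr (_, _); rewrite /= scaler0. Qed.

Lemma te_inrZ (c : k) (phi : 'Hom(A, k^o)) :
  c *: ((0, phi) : trivext A) = (0, c *: phi).
Proof. by congr (_, _); rewrite /= scaler0. Qed.

Lemma te_inl_sum (I : Type) (r : seq I) (F : I -> A) :
  \sum_(q <- r) ((F q, 0) : trivext A) = (\sum_(q <- r) F q, 0).
Proof. by elim/big_rec2: _ => // q y _ _ ->; congr (_, _); rewrite /= addr0. Qed.

Lemma te_inr_sum (I : Type) (r : seq I) (F : I -> 'Hom(A, k^o)) :
  \sum_(q <- r) ((0, F q) : trivext A) = (0, \sum_(q <- r) F q).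
Proof. by elim/big_rec2: _ => // q y _ _ ->; congr (_, _); rewrite /= addr0. Qed.

End TrivialExtensionPairs.

Section TrivialExtensionAn.
Variables (k : fieldType) (n : nat).
Local Notation A := (pathalg k n.+1).
Local Notation T := (trivext A).
Implicit Types (a b c d i j s t : nat).

(* The path from a to b, and the corresponding element of the dual basis; both
   are 0 unless a <= b <= n. *)
Definition pth a b : A := [ffun q => ((psrc q == a :> nat) && (ptgt q == b :> nat))%:R].

Definition dpth a b : 'Hom(A, k^o) :=
  linfun (fun f : A => \sum_(q | (psrc q == a :> nat) && (ptgt q == b :> nat)) (f q : k^o)).

Lemma pa_pathE (q : path_An n.+1) : pa_path k q = pth (psrc q) (ptgt q).
Proof.
by apply/ffunP => r; rewrite !ffunE.
Qed.

Lemma pthP a b : (a <= b <= n)%N ->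
  exists q : path_An n.+1, [/\ pth a b = pa_path k q, psrc q = a :> nat & ptgt q = b :> nat].
Proof.
case/andP=> le_ab le_bn.
have lt_a : (a < n.+1)%N by rewrite ltnS (leq_trans le_ab).
have lt_b : (b < n.+1)%N by [].
exists (@mkpath _ (Ordinal lt_a) (Ordinal lt_b) le_ab).
by rewrite pa_pathE.
Qed.

Lemma path_range (q : path_An n.+1) : (psrc q <= ptgt q <= n)%N.
Proof. by rewrite (valP q) -ltnS ltn_ord. Qed.

Lemma pth_out a b : ~~ (a <= b <= n)%N -> pth a b = 0.
Proof.
move=> nab; apply/ffunP => q; rewrite !ffunE; case: andP => // -[/eqP qa /eqP qb].
by have := path_range q; rewrite qa qb (negPf nab).
Qed.

Lemma pth_mul a b c d : (a <= b <= n)%N -> (c <= d <= n)%N ->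
  pth c d * pth a b = if b == c then pth a d else 0.
Proof.
move=> /pthP[q [-> qa qb]] /pthP[r [-> rc rd]].
rewrite -[LHS]/(pa_mul _ _) pa_mul_path; case: eqP => [bc|nbc]; last first.
  by rewrite /Defs.pcomp -val_eqE /= qb rc (introF eqP nbc).
have [|p [_ pa pd]] := @pthP a d.
  have := path_range q; have := path_range r.
  by rewrite qa qb rc rd bc => /andP[cd ->] /andP[ac _]; rewrite (leq_trans ac cd).
have -> : Defs.pcomp r q = Some p.
  by apply/eqP; rewrite pcompP -!val_eqE /= qa qb rc rd pa pd bc !eqxx.
by rewrite pa_pathE pa pd.
Qed.

Lemma dpthE a b (f : A) :
  dpth a b f = \sum_(q | (psrc q == a :> nat) && (ptgt q == b :> nat)) (f q : k^o).
Proof.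
apply: (@linfun_linearE k A k^o) => c u v.
by rewrite scaler_sumr -big_split; apply: eq_bigr => q _; rewrite /= !ffunE.
Qed.

Lemma dpth_pth a b c d : (c <= d <= n)%N ->
  dpth a b (pth c d) = ((a == c) && (b == d))%:R.
Proof.
case/pthP=> q [-> qc qd]; rewrite dpthE big_mkcond (bigD1 q) //= ffunE eqxx qc qd.
rewrite big1 ?addr0 => [|r /negPf nr]; first by rewrite !(eq_sym _ a) !(eq_sym _ b); case: ifP.
by rewrite ffunE nr; case: ifP.
Qed.

Lemma dual_ext (phi psi : 'Hom(A, k^o)) :
  (forall c d, (c <= d <= n)%N -> phi (pth c d) = psi (pth c d)) -> phi = psi.
Proof.
move=> eq_pth; apply/lfunP => f; rewrite (pa_span f) !linear_sum.
by apply: eq_bigr => q _; rewrite !linearZ /= pa_pathE eq_pth // path_range.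
Qed.

Lemma dpth_out a b : ~~ (a <= b <= n)%N -> dpth a b = 0.
Proof.
move=> nab; apply: dual_ext => c d cd; rewrite dpth_pth // zero_lfunE.
by case: andP => // -[/eqP ac /eqP bd]; rewrite ac bd cd in nab.
Qed.

Definition arrows : A := \sum_(s < n) pth s s.+1.

Lemma arrows_mul a b : (a <= b <= n)%N -> arrows * pth a b = pth a b.+1.
Proof.
move=> ab; rewrite mulr_suml; case: (ltnP b n) => [lt_bn|le_nb]; last first.
  rewrite big1 => [|s _]; first by rewrite pth_out //; lia.
  by rewrite pth_mul //; [case: eqP => // bs | ]; have := ltn_ord s; lia.
rewrite (bigD1 (Ordinal lt_bn)) //= pth_mul //= ?eqxx; last by lia.
rewrite big1 ?addr0 // => s; rewrite -val_eqE /= eq_sym => /negPf ns.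
by rewrite pth_mul ?ns //; have := ltn_ord s; lia.
Qed.

Lemma mul_arrows c d : (c <= d <= n)%N ->
  pth c d * arrows = if (0 < c)%N then pth c.-1 d else 0.
Proof.
move=> cd; rewrite mulr_sumr; case: c cd => [|c] cd /=.
  by rewrite big1 // => s _; rewrite pth_mul //; have := ltn_ord s; lia.
have lt_cn : (c < n)%N by lia.
rewrite (bigD1 (Ordinal lt_cn)) //= pth_mul //= ?eqxx; last by lia.
rewrite big1 ?addr0 // => s; rewrite -val_eqE /= => /negPf ns.
by rewrite pth_mul ?eqSS ?ns //; have := ltn_ord s; lia.
Qed.

Definition te_idem i : T := (pth (i %% n.+1) (i %% n.+1), 0).

(** The arrow from the last vertex back to the first is the dual of the longest path. *)
Definition te_cycle : T := (arrows, dpth 0 n).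

(* The element of degree t in T e_i: first the paths starting at i, then the
   dual paths ending at i. *)
Definition te_chain i t : T :=
  if (i + t <= n)%N then (pth i (i + t), 0) else (0, dpth (i + t - n.+1) i).

Lemma te_mulE (u v : T) : u * v = (u.1 * v.1, dlact u.1 v.2 + dract u.2 v.1).
Proof. by []. Qed.

Lemma dlact0 (a : A) : dlact a 0 = 0.
Proof. by apply/lfunP => y; rewrite dlactE !zero_lfunE. Qed.
Lemma dract0 (a : A) : dract 0 a = 0.
Proof. by apply/lfunP => y; rewrite dractE !zero_lfunE. Qed.
Lemma dract0r (f : 'Hom(A, k^o)) : dract f 0 = 0.
Proof. by apply/lfunP => y; rewrite dractE mul0r linear0 zero_lfunE. Qed.

(** [arrows] extends a path until it ends at n, [dpth 0 n] turns the path from i to n into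
    [dpth 0 i], and [arrows] then raises the source of the dual path up to i. *)
Lemma te_mul_chain i t : (i <= n)%N -> te_cycle * te_chain i t = te_chain i t.+1.
Proof.
move=> le_in; rewrite te_mulE /te_chain addnS; case: (leqP (i + t) n) => [le_itn|lt_nit] /=.
  rewrite dlact0 add0r arrows_mul; last by rewrite leq_addr.
  have dE c d : (c <= d <= n)%N ->
      dract (dpth 0 n) (pth i (i + t)) (pth c d) = ((i + t == n) && (c == 0) && (d == i))%:R.
    move=> cd; rewrite dractE pth_mul // ?leq_addr //.
    case: (eqVneq d i) => [e|_]; last by rewrite linear0 andbF.
    rewrite dpth_pth; last by lia.
    by rewrite andbT andbC [0%N == c]eq_sym [n == _]eq_sym.
  case: ltnP => [lt_itn|le_nit]; congr (_, _).
  - by apply: dual_ext => c d cd; rewrite dE // zero_lfunE (ltn_eqF lt_itn).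
  - by rewrite pth_out //; lia.
  - apply: dual_ext => c d cd; rewrite dE // dpth_pth // (_ : _.+1 - _ = 0)%N; last by lia.
    by rewrite [X in X && _ && _](_ : _ = true) ?[c == _]eq_sym ?[d == _]eq_sym //; lia.
rewrite ltnNge ltnW //= mulr0 dract0r addr0; congr (_, _).
apply: dual_ext => c d cd; rewrite dlactE mul_arrows // dpth_pth //.
case: c cd => [|c] cd /=; first by rewrite linear0; case: eqP => //; lia.
by rewrite dpth_pth; [congr (_ && _)%:R; apply/eqP/eqP | ]; lia.
Qed.

Lemma te_chainE i t : te_cycle ^+ t * te_idem i = te_chain (i %% n.+1) t.
Proof.
have le_in : (i %% n.+1 <= n)%N by rewrite -ltnS ltn_pmod.
elim: t => [|t IH]; first by rewrite expr0 mul1r /te_chain addn0 le_in.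
by rewrite exprS -mulrA IH te_mul_chain.
Qed.

Lemma te_chain_large i : te_chain i n.+2 = 0.
Proof. by rewrite /te_chain ifN ?dpth_out //; lia. Qed.

Lemma te_idem_cycle i : te_idem i.+1 * te_cycle = te_cycle * te_idem i.
Proof.
have := te_chainE i 1; rewrite expr1 => ->.
have le_in : (i %% n.+1 <= n)%N by rewrite -ltnS ltn_pmod.
have jE : (i.+1 %% n.+1)%N = if (i %% n.+1 < n)%N then (i %% n.+1).+1 else 0%N.
  rewrite -addn1 -modnDml addn1; case: ltnP => [lt_in|le_ni].
    by rewrite modn_small.
  by rewrite (_ : (i %% n.+1).+1 = n.+1) ?modnn //; lia.
rewrite te_mulE /te_idem /te_chain /= jE addn1 dract0 addr0.
set i' := (i %% n.+1)%N in le_in *; set j := if _ then _ else _.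
have jn : (j <= j <= n)%N by rewrite leqnn /j; case: ifP.
have dE c d : (c <= d <= n)%N ->
    dlact (pth j j) (dpth 0 n) (pth c d) = ((j == 0) && (c == 0) && (d == n))%:R.
  move=> cd; rewrite dlactE pth_mul // [d == n]eq_sym.
  case: (eqVneq j c) => [e|njc]; last first.
    by rewrite linear0; case: andP => // -[/andP[/eqP j0 /eqP c0]]; rewrite j0 c0 in njc.
  by rewrite dpth_pth ?e // [0%N == c]eq_sym andbb.
rewrite mul_arrows //; case: ltnP @j jn dE => /= [lt_in|le_ni] _ dE.
  by congr (_, _); apply: dual_ext => c d cd; rewrite dE // zero_lfunE.
have i'n : i' = n by lia.
congr (_, _); apply: dual_ext => c d cd; rewrite dE // i'n subnn dpth_pth //.
by rewrite /= [c == _]eq_sym [d == _]eq_sym.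
Qed.

Lemma te_span (u : T) : exists c : nat -> nat -> k,
  u = \sum_(t < n.+2) \sum_(i < n.+1) c t i *: (te_cycle ^+ t * te_idem i).
Proof.
pose S (u : T) := exists c : nat -> nat -> k,
  u = \sum_(t < n.+2) \sum_(i < n.+1) c t i *: (te_cycle ^+ t * te_idem i).
have SD v w : S v -> S w -> S (v + w).
  move=> [c ->] [c' ->]; exists (fun t i => c t i + c' t i).
  rewrite -big_split; apply: eq_bigr => t _; rewrite -big_split.
  by apply: eq_bigr => i _; rewrite scalerDl.
have SZ (a : k) v : S v -> S (a *: v).
  move=> [c ->]; exists (fun t i => a * c t i).
  by rewrite scaler_sumr; apply: eq_bigr => t _; rewrite scaler_sumr;
    apply: eq_bigr => i _; rewrite scalerA.
have S0 : S 0.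
  exists (fun _ _ => 0); rewrite big1 // => t _; rewrite big1 // => i _.
  by rewrite scale0r.
have Schain i t : (i <= n)%N -> (t <= n.+1)%N -> S (te_chain i t).
  move=> le_in le_tn; exists (fun t' i' => ((t' == t) && (i' == i))%:R).
  have lt_t : (t < n.+2)%N by [].
  have lt_i : (i < n.+1)%N by [].
  rewrite (bigD1 (Ordinal lt_t)) //= (bigD1 (Ordinal lt_i)) //= !eqxx scale1r te_chainE.
  rewrite modn_small // !big1 ?addr0 // => [t'|i'].
    by rewrite -val_eqE /= => /negPf nt; rewrite big1 // => i' _; rewrite nt scale0r.
  by rewrite -val_eqE /= => /negPf ni; rewrite ni scale0r.
have sumT (F : path_An n.+1 -> T) :
    (forall q, S (F q)) -> S (\sum_q F q).
  by move=> SF; elim/big_ind: _.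
have -> : u =
    \sum_(q : path_An n.+1) (u.1 q : k) *: ((pth (psrc q) (ptgt q), 0) : T)
    + \sum_(q : path_An n.+1) (u.2 (pth (psrc q) (ptgt q)) : k) *:
        ((0, dpth (psrc q) (ptgt q)) : T).
  transitivity ((u.1, 0) + (0, u.2) : T).
    by case: u => f phi; congr (_, _); rewrite /= ?addr0 ?add0r.
  congr (_ + _).
    rewrite {1}[u.1]pa_span -te_inl_sum; apply: eq_bigr => q _.
    by rewrite pa_pathE te_inlZ.
  have u2E : u.2 =
      \sum_(q : path_An n.+1) (u.2 (pth (psrc q) (ptgt q)) : k) *: dpth (psrc q) (ptgt q).
    apply: dual_ext => c d cd; rewrite sum_lfunE.
    have [q [-> qc qd]] := pthP cd; rewrite pa_pathE (bigD1 q) //= scale_lfunE.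
    rewrite dpth_pth ?path_range // !eqxx [_ *: _]mulr1 big1 ?addr0 // => r nr.
    rewrite scale_lfunE dpth_pth ?path_range //; case: andP => [[/eqP rs /eqP rt]|_].
      by case/eqP: nr; apply: path_eq; apply: val_inj.
    exact: mulr0.
  rewrite {1}u2E -te_inr_sum; apply: eq_bigr => q _.
  by rewrite te_inrZ.
(* The path from a to b has degree b - a in T e_a; its dual has degree a + n + 1 - b in T e_b. *)
apply: SD; apply: sumT => q; apply: SZ; have := path_range q => qn.
  rewrite (_ : (_, _) = te_chain (psrc q) (ptgt q - psrc q)); first by apply: Schain; lia.
  by rewrite /te_chain subnKC ?ifT //; lia.
rewrite (_ : (_, _) = te_chain (ptgt q) (psrc q + n.+1 - ptgt q)); first by apply: Schain; lia.
by rewrite /te_chain ifN; [congr (_, dpth _ _) | ]; lia.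
Qed.

Lemma te_idem_sum : \sum_(i < n.+1) te_idem i = 1.
Proof.
rewrite te_inl_sum; congr (_, _).
apply: eq_bigr => i _; rewrite pa_pathE /psrc /ptgt /=.
by rewrite modn_small.
Qed.

Lemma trivext_nakayama : nakayama n te_idem te_cycle.
Proof.
split.
- move=> i j; rewrite te_mulE dlact0 dract0 addr0 /te_idem /=.
  have modP s : (s %% n.+1 <= s %% n.+1 <= n)%N by rewrite leqnn -ltnS ltn_pmod.
  by rewrite pth_mul // eq_sym; case: eqP => // ->.
- exact: te_idem_sum.
- by move=> i; rewrite te_idem_cycle.
- rewrite -[LHS]mulr1 -te_idem_sum mulr_sumr big1 // => i _.
  by rewrite te_chainE te_chain_large.
- move=> i; rewrite te_chainE /te_chain ifN; last by lia.
  have le_in : (i %% n.+1 <= i %% n.+1 <= n)%N by rewrite leqnn -ltnS ltn_pmod.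
  apply/eqP => /(congr1 snd) /= /lfunP/(_ (pth (i %% n.+1) (i %% n.+1))).
  by rewrite addnK dpth_pth // !eqxx zero_lfunE => /eqP; rewrite oner_eq0.
- exact: te_span.
Qed.
End TrivialExtensionAn.

(** * The modules L(P_i) as uniserial modules of maximal length *)

Section ProjectivesL.
Variables (k : fieldType) (n : nat).
Local Notation A := (pathalg k n.+1).
Local Notation T := (trivext A).

Lemma videm_mem (i : 'I_n.+1) : videm k i \in limg (amulr (videm k i)).
Proof. by apply/memv_imgP; exists 1; [exact: memvf | rewrite lfunE /= mul1r]. Qed.

Definition Pgen (i : 'I_n.+1) : Pproj k i := Subvs (videm_mem i).

Lemma pth_videm (i : 'I_n.+1) : pth k n i i = videm k i.
Proof. by rewrite /videm pa_pathE. Qed.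

Lemma videm_idem (i : 'I_n.+1) : videm k i * videm k i = videm k i.
Proof. by rewrite -!pth_videm pth_mul ?eqxx // leqnn -ltnS ltn_ord. Qed.

Lemma Pgen_cyclic (i : 'I_n.+1) (y : Pproj k i) : exists a, y = lact (Pproj k i) a (Pgen i).
Proof.
have /memv_imgP[a _ aE] := subvsP y; exists a; apply: val_inj.
by rewrite /= aE lfunE.
Qed.

Lemma tens_sumE (X : fdmod A) (w : X) (I : Type) (r : seq I) (F : I -> 'Hom(A, k^o)) :
  \sum_(s <- r) tens (F s) w = tens (\sum_(s <- r) F s) w.
Proof.
elim/big_rec2: _ => [|s f y _ ->]; first by rewrite /tens tensk0l linear0.
by have := tensDl w 1 (F s) f; rewrite !scale1r => ->.
Qed.

(** As P_i is generated by e_i, coefficients move across the tensor sign and every tensor becomes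
    pure. *)
Lemma tens_Pgen (i : 'I_n.+1) (z : nu (Pproj k i)) : exists phi, z = tens phi (Pgen i).
Proof.
pose P := Pproj k i; pose w : P := Pgen i.
have /fin_all_exists[a aE] : forall s : 'I_(\dim {:A}), exists a,
    (qrep z : 'Hom(A, P)) (vbasis {:A})`_s = lact P a w by move=> s; apply: Pgen_cyclic.
exists (\sum_s dract (dcoord s) (a s)); rewrite -tens_sumE.
rewrite -[z](qrepK (U := nu_rel P)) [qrep z]tensk_span linear_sum.
by apply: eq_bigr => s _; rewrite tensB aE.
Qed.

(** The evaluation phi (x) y |-> phi(y) is balanced, so it is defined on nu(P_i) and detects the
    tensor. *)
Lemma tens_Pgen_neq0 (i : 'I_n.+1) (phi : 'Hom(A, k^o)) :
  phi (videm k i) != 0 -> tens phi (Pgen i) != 0.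
Proof.
have [|||F FE] := @nu_lift k A (Pproj k i) k^o (fun phi y => phi (vsval y)).
- by move=> y c f g; rewrite add_lfunE scale_lfunE.
- by move=> f c y z; rewrite /= linearP.
- by move=> f b y; rewrite dractE.
by apply: contra => /eqP t0; have := FE phi (Pgen i); rewrite t0 linear0 /= => <-.
Qed.

Lemma L_uniserial (i : 'I_n.+1) :
  exists g : L (Pproj k i), uniserial (te_idem k n) (te_cycle k n) i n.+1 g.
Proof.
pose P := Pproj k i; pose w : P := Pgen i.
have tens0 (v : P) : tens 0 v = 0 by rewrite /tens tensk0l linear0.
pose g : L P := (w, 0); exists g.
have eg : lact (L P) (te_idem k n i) g = g.
  rewrite L_actE /= tens0 linear0 addr0; congr (_, _); last exact: linear0.
  by apply: val_inj; rewrite /= modn_small // pth_videm videm_idem.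
split; first exact: eg.
- rewrite -eg -lactM te_chainE modn_small // /te_chain ifN; last by lia.
  rewrite addnK L_actE; apply/eqP => /(congr1 snd) g0.
  have {}g0 : lact (nu P) 0 0 + tens (dpth k n i i) w = 0 by exact: g0.
  move/eqP: g0; rewrite linear0 add0r; apply/negP/tens_Pgen_neq0.
  by rewrite -pth_videm dpth_pth ?eqxx ?oner_neq0 // leqnn -ltnS ltn_ord.
- exact: (lactX_large (trivext_nakayama k n)) (ltnSn _).
case=> y z; have [a ->] := Pgen_cyclic y; have [phi ->] := tens_Pgen z.
exists (a, phi); rewrite L_actE; congr (_, _).
by rewrite -[RHS]/(lact (nu P) a 0 + tens phi w) linear0 add0r.
Qed.

Lemma L_indecomposable (i : 'I_n.+1) : indecomposable (L (Pproj k i)).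
Proof.
have [g ug] := L_uniserial i.
exact: uniserial_indecomposable (trivext_nakayama k n) _ _ _ _ ug.
Qed.

(** The map g |-> e_i into T is split by b |-> b g, because e_i g = g. *)
Lemma L_summand_regmod (i : 'I_n.+1) : is_summand (L (Pproj k i)) (regmod T).
Proof.
have nakT := trivext_nakayama k n.
have [g ug] := L_uniserial i; have [eg _ _ genL] := ug.
have [||f hf fE] := uniserial_hom nakT ug (Y := regmod T) (h := te_idem k n i).
- exact: nak_idem nakT _.
- exact: (lactX_large nakT) (ltnSn _).
apply: (maps_summand hf (orbit_map_hom g)); exists id => y;
  by have [b ->] := genL y; rewrite comp_lfunE fE orbit_mapE lactM eg.
Qed.

Lemma L_iso_inj (i j : 'I_n.+1) : iso (L (Pproj k i)) (L (Pproj k j)) -> i = j.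
Proof.
have [g ug] := L_uniserial i; have [h uh] := L_uniserial j.
move/(uniserial_max_top (trivext_nakayama k n) ug uh).
by rewrite !modn_small // => /val_inj.
Qed.

End ProjectivesL.

(** * Counting the summands of a tau-rigid module *)

Section Main.
Variables (k : fieldType) (n : nat).
Local Notation T := (trivext (pathalg k n.+1)).

Lemma tau_rigid_num_summands (M : fdmod T) : basic M -> tau_rigid M ->
  exists2 m, num_summands M m &
    (exists i : 'I_n.+1, is_summand (L (Pproj k i)) M) \/ (m <= n)%N.
Proof.
move=> basM rigM; have nakT := trivext_nakayama k n.
have [m [X [numM indX sumX injX]]] := basic_num_summands basM.
exists m => //.
have /fin_all_exists[a] i := indecomposable_uniserial nakT (indX i).
case/fin_all_exists=> l lP.
have [j /eqP lj|l_n] := pickP (fun j => l j == n.+1).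
  left; exists (a j); have [g ug] := lP j; have [h uh] := L_uniserial k (a j).
  apply: is_summand_isol (sumX j); rewrite lj in ug.
  exact: (uniserial_iso nakT ug uh).
right; have le_l j : (l j <= n)%N.
  have [g /(uniserial_length nakT)] := lP j.
  by rewrite leq_eqVlt l_n.
(* The index l stands for length l + 1, whence the successor in the length of the arc. *)
apply: (@noncrossing_arcs_bound n m (fun i => a i) (fun i => (l i).+1)) => // i j.
  move=> t; rewrite ltnS => le_t ijt; have [g ug] := lP i; have [h uh] := lP j.
  exact: (tau_rigid_uniserials nakT rigM (sumX i) (sumX j) ug uh (le_l i) le_t ijt).
move=> /val_inj eq_a [eq_l]; apply: injX; have [g ug] := lP i; have [h uh] := lP j.
rewrite -eq_a -eq_l in uh; exact: (uniserial_iso nakT ug uh).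
Qed.

End Main.

(* The quiver A_n with n >= 1 vertices is written with n.+1 for n. *)
Theorem corollary4p3 (k : fieldType) (n : nat) :
  (forall M : fdmod (trivext (pathalg k n.+1)),
     basic M -> tau_rigid M ->
     (forall i : 'I_n.+1, ~ in_add (L (Pproj k i)) M) ->
     exists2 m : nat, num_summands M m & (m <= n.+1.-1)%N) /\
  (forall M : fdmod (trivext (pathalg k n.+1)),
     basic M -> tau_tilting M ->
     exists i : 'I_n.+1, is_summand (L (Pproj k i)) M).
Proof.
split=> M basM.
  move=> rigM noL; have [m numM [[i /is_summand_in_add/noL]|le_mn]] // :=
    tau_rigid_num_summands basM rigM.
  by exists m.
case=> rigM [m numM numT].
have [m' numM' [//|]] := tau_rigid_num_summands basM rigM.
rewrite -(num_summands_uniq numM numM') leqNgt => /negP[].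
(* The L(P_i) are n + 1 pairwise non-isomorphic indecomposable summands of T, so |M| = |T| exceeds
   n. *)
apply: num_summands_ge numT (fun i => conj _ _) (@L_iso_inj k n).
  exact: L_indecomposable.
exact: L_summand_regmod.
Qed.
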